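(* Let $\Gamma$ be a finite combinatorial graph, let $G_\Gamma$ be the associated right-angled Artin group, and let $\mathbb{F}$ be a finite field. Then the cohomology algebra $H^\bullet(G_\Gamma,\mathbb{F})=\bigoplus_{n\ge 0}H^n(G_\Gamma,\mathbb{F})$ is strongly Koszul.
   Context: Graphs: a graph is a pair $\Gamma=(\mathcal{V},\mathcal{E})$ with $\mathcal{V}$ a finite set of vertices and $\mathcal{E}$ a set of unordered pairs $(v,w)=(w,v)$ of distinct vertices (no loops, no multiple edges). If $\mathcal{V}=\{v_1,\ldots,v_d\}$, the right-angled Artin group (RAAG) associated to $\Gamma$ is the group with presentation $G_\Gamma=\langle v_1,\ldots,v_d\mid [v_i,v_j]=1 \text{ for } (v_i,v_j)\in\mathcal{E}\rangle$. Cohomology: $\mathbb{F}$ is a trivial $G_\Gamma$-module and $H^\bullet(G_\Gamma,\mathbb{F})$ is a graded algebra with the cup-product. (It is well known to be a quadratic algebra.) Quadratic algebras: a graded $\mathbb{F}$-algebra $A_\bullet=\bigoplus_{n\ge0}A_n$ is quadratic if it is isomorphic, as a graded algebra, to $T_\bullet(V)/(\Omega)$, where $V$ is a finite-dimensional $\mathbb{F}$-vector space, $T_\bullet(V)$ is its tensor algebra, $\Omega\le V\otimes V$ is a subspace, and $(\Omega)$ is the two-sided ideal generated by $\Omega$. For a subset $S$ of $A_\bullet$, $(S)$ denotes the two-sided ideal generated by $S$. For ideals $I,J$ of $A_\bullet$, the colon ideal is $I:J=\{a\in A_\bullet\mid a\cdot J\subseteq I\}$. Strong Koszulity: a quadratic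 algebra $A_\bullet$ is strongly Koszul if $A_1$ has a basis $\mathcal{X}=\{u_1,\ldots,u_d\}$ such that for every subset $\{u_{i_1},\ldots,u_{i_k}\}$ of $\mathcal{X}$ and every $r\in\{1,\ldots,k-1\}$ the colon ideal $(u_{i_1},\ldots,u_{i_{r-1}}):(u_{i_r})$ is generated by a subset of $\mathcal{X}$ (for $r=1$ the first ideal is $(0)$). *)

(* Defs.v *)
From HB Require Import structures.
From mathcomp Require Import all_boot all_order all_algebra.
From mathcomp Require Import ring.
From mathcomp Require Import boolp classical_sets functions.

Set Implicit Arguments.
Unset Strict Implicit.
Unset Printing Implicit Defensive.

Import GRing.Theory.

Local Open Scope classical_set_scope.
Local Open Scope quotient_scope.
Local Open Scope ring_scope.

Section PresentedGroup.
Variable X : Type.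

(* The letter (x, true) stands for x and (x, false) for x^-1. *)
Definition word := seq (X * bool).

Definition inv_letter (l : X * bool) : X * bool := (l.1, ~~ l.2).

Definition inv_word (s : word) : word := rev (map inv_letter s).

Inductive pres_eq (R : set word) : word -> word -> Prop :=
| PresRefl s : pres_eq R s s
| PresSym s t : pres_eq R s t -> pres_eq R t s
| PresTrans s t u : pres_eq R s t -> pres_eq R t u -> pres_eq R s u
| PresCat s s' t t' :
    pres_eq R s s' -> pres_eq R t t' -> pres_eq R (s ++ t) (s' ++ t')
| PresCancel l : pres_eq R [:: l; inv_letter l] [::]
| PresRel r : R r -> pres_eq R r [::].

Lemma inv_letterK : involutive inv_letter.
Proof. by case=> x b; rewrite /inv_letter /= negbK. Qed.

Lemma inv_word_cat s t : inv_word (s ++ t) = inv_word t ++ inv_word s.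
Proof. by rewrite /inv_word map_cat rev_cat. Qed.

Lemma inv_wordK : involutive inv_word.
Proof. by move=> s; rewrite /inv_word map_rev revK mapK //; exact: inv_letterK. Qed.

Lemma pres_catV R s : pres_eq R (s ++ inv_word s) [::].
Proof.
elim: s => [|l s IHs]; first exact: PresRefl.
have -> : (l :: s) ++ inv_word (l :: s)
        = [:: l] ++ ((s ++ inv_word s) ++ [:: inv_letter l]).
  by rewrite /inv_word /= rev_cons -cats1 !catA.
apply: PresTrans (PresCancel R l).
have -> : [:: l; inv_letter l] = [:: l] ++ ([::] ++ [:: inv_letter l]) by [].
by do 2?apply: PresCat => //; exact: PresRefl.
Qed.

Lemma pres_catVl R s : pres_eq R (inv_word s ++ s) [::].
Proof. by rewrite -{2}(inv_wordK s); apply: pres_catV. Qed.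

Lemma pres_inv R s t : pres_eq R s t -> pres_eq R (inv_word s) (inv_word t).
Proof.
move=> st; apply: (@PresTrans _ _ (inv_word s ++ (t ++ inv_word t))).
  rewrite -[X in pres_eq _ X _]cats0; apply: PresCat; first exact: PresRefl.
  by apply: PresSym; apply: pres_catV.
apply: (@PresTrans _ _ (inv_word s ++ (s ++ inv_word t))).
  apply: PresCat; first exact: PresRefl.
  by apply: PresCat; [apply: PresSym | exact: PresRefl].
rewrite catA -[X in pres_eq _ _ X]cat0s; apply: PresCat; last exact: PresRefl.
exact: pres_catVl.
Qed.

Definition pres_eqb R : rel word := fun s t => `[< pres_eq R s t >].

Lemma pres_equiv R : equiv_class_of (pres_eqb R).
Proof.
split=> [s|s t|t s u]; first by apply/asboolP; exact: PresRefl.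
  by apply/asboolP/asboolP; exact: PresSym.
by move=> /asboolP st /asboolP tu; apply/asboolP; exact: PresTrans st tu.
Qed.
End PresentedGroup.

Section PresentedGroupType.
Variables (X : choiceType) (R : set (word X)).

Canonical pres_equiv_rel := EquivRelPack (pres_equiv R).
Canonical pres_enc_mod_rel := defaultEncModRel (pres_eqb R).

Definition pres_group := {eq_quot pres_eqb R}.
HB.instance Definition _ : EqQuotient _ (pres_eqb R) pres_group :=
  EqQuotient.on pres_group.
HB.instance Definition _ := Choice.on pres_group.

Definition pres_pi (s : word X) : pres_group := \pi_pres_group s.

Lemma pres_reprK (g : pres_group) : pres_pi (repr g) = g.
Proof. exact: reprK. Qed.

Definition pres_one : pres_group := pres_pi [::].
Definition pres_mul (g h : pres_group) : pres_group := pres_pi (repr g ++ repr h).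
Definition pres_invg (g : pres_group) : pres_group := pres_pi (inv_word (repr g)).

Lemma pres_piP s t : pres_pi s = pres_pi t <-> pres_eq R s t.
Proof.
split=> [/eqP|st]; first by rewrite /pres_pi piE => /asboolP.
by apply/eqP; rewrite /pres_pi piE; apply/asboolP.
Qed.

Lemma pres_repr s : pres_eq R (repr (pres_pi s)) s.
Proof. by apply/pres_piP; rewrite pres_reprK. Qed.

Lemma pres_mul_pi s t : pres_mul (pres_pi s) (pres_pi t) = pres_pi (s ++ t).
Proof. by apply/pres_piP; apply: PresCat; apply: pres_repr. Qed.

Lemma pres_inv_pi s : pres_invg (pres_pi s) = pres_pi (inv_word s).
Proof. by apply/pres_piP; apply: pres_inv; apply: pres_repr. Qed.

Lemma pres_mulA : associative pres_mul.
Proof.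
move=> x y z; rewrite -[x]pres_reprK -[y]pres_reprK -[z]pres_reprK !pres_mul_pi.
by rewrite catA.
Qed.

Lemma pres_mul1 : left_id pres_one pres_mul.
Proof. by move=> x; rewrite -[x]pres_reprK pres_mul_pi. Qed.

Lemma pres_mulr1 : right_id pres_one pres_mul.
Proof. by move=> x; rewrite -[x]pres_reprK pres_mul_pi cats0. Qed.

Lemma pres_mulV : left_inverse pres_one pres_invg pres_mul.
Proof.
move=> x; rewrite -[x]pres_reprK pres_inv_pi pres_mul_pi.
by apply/pres_piP; apply: pres_catVl.
Qed.

Lemma pres_mulrV : right_inverse pres_one pres_invg pres_mul.
Proof.
move=> x; rewrite -[x]pres_reprK pres_inv_pi pres_mul_pi.
by apply/pres_piP; apply: pres_catV.
Qed.

HB.instance Definition _ := isGroup.Build pres_group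
  pres_mulA pres_mul1 pres_mulr1 pres_mulV pres_mulrV.
End PresentedGroupType.

Record sgraph := SGraph {
  vertex :> finType;
  adj : rel vertex;
  adj_sym : symmetric adj;
  adj_irr : irreflexive adj }.

Definition comm_word (X : Type) (x y : X) : word X :=
  [:: (x, false); (y, false); (x, true); (y, true)].

Definition raag (Gamma : sgraph) : groupType :=
  pres_group [set r | exists v w : Gamma, adj v w /\ r = comm_word v w].

Section Ideals.
Variables (F : fieldType) (A : algType F).

(* Two-sided ideals; they are automatically stable under scaling, since
   k *: a = k%:A * a. *)
Definition is_ideal (I : set A) : Prop :=
  [/\ I 0, forall a b, I a -> I b -> I (a + b),
      forall a b, I b -> I (a * b) & forall a b, I a -> I (a * b)].

Definition ideal_gen (S : set A) : set A :=
  [set a | forall I, is_ideal I -> S `<=` I -> I a].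

Definition colon (I J : set A) : set A :=
  [set a | forall b, J b -> I (a * b)].

Definition is_subspace (U : set A) : Prop :=
  U 0 /\ forall k a b, U a -> U b -> U (k *: a + b).

Definition is_basis (U : set A) (d : nat) (u : 'I_d -> A) : Prop :=
  [/\ forall i, U (u i),
      forall a, U a -> exists c : 'I_d -> F, a = \sum_i c i *: u i &
      forall c : 'I_d -> F, \sum_i c i *: u i = 0 -> forall i, c i = 0].

Lemma ideal_gen_ideal S : is_ideal (ideal_gen S).
Proof.
split=> [I [] //|a b Sa Sb I idI SI|a b Sb I idI SI|a b Sa I idI SI].
- by case: (idI) => _ + _ _; apply; [apply: Sa | apply: Sb].
- by case: (idI) => _ _ + _; apply; apply: Sb.
- by case: (idI) => _ _ _; apply; apply: Sa.
Qed.

(* algType only has nonzero algebras, whence the properness. *)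
Record proper_ideal := ProperIdeal {
  ideal_set :> set A;
  idealP : is_ideal ideal_set;
  ideal_proper : ~ ideal_set 1 }.
End Ideals.

Section QuotientAlgebra.
Variables (F : fieldType) (A : algType F) (I : proper_ideal A).

Definition ideal_pred : {pred A} := fun a => `[< ideal_set I a >].

Lemma ideal_zmod_closed : zmod_closed ideal_pred.
Proof.
have [I0 ID Il _] := idealP I.
split=> [|a b]; first exact/asboolP.
move=> /asboolP Ia /asboolP Ib; apply/asboolP; apply: ID => //.
by rewrite -mulN1r; apply: Il.
Qed.
HB.instance Definition _ := GRing.isZmodClosed.Build A ideal_pred
  ideal_zmod_closed.

Definition quot_alg := Quotient.quot (ideal_pred : zmodClosed A).
HB.instance Definition _ := GRing.Zmodule.on quot_alg.

Definition quot_pi (a : A) : quot_alg := \pi_(Quotient.quot (ideal_pred : zmodClosed A)) a.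

Lemma quot_piP a b : quot_pi a = quot_pi b <-> ideal_set I (a - b).
Proof.
split=> [/eqP|Iab].
  by rewrite /quot_pi -Quotient.idealrBE => /asboolP.
by apply/eqP; rewrite /quot_pi -Quotient.idealrBE; apply/asboolP.
Qed.

Lemma quot_piS x : exists a, x = quot_pi a.
Proof. by exists (repr x); rewrite /quot_pi reprK. Qed.

Lemma quot_piB a b : quot_pi (a - b) = quot_pi a - quot_pi b.
Proof. by exact: raddfB. Qed.

Lemma quot_piD a b : quot_pi (a + b) = quot_pi a + quot_pi b.
Proof. by exact: raddfD. Qed.

Definition quot_one : quot_alg := quot_pi 1.
Definition quot_mul (x y : quot_alg) : quot_alg := quot_pi (repr x * repr y).
Definition quot_scale (k : F) (x : quot_alg) : quot_alg := quot_pi (k *: repr x).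

Lemma quot_repr a : ideal_set I (repr (quot_pi a) - a).
Proof. by apply/quot_piP; rewrite {1}/quot_pi reprK. Qed.

Lemma quot_mulE a b : quot_mul (quot_pi a) (quot_pi b) = quot_pi (a * b).
Proof.
have [_ ID Il Ir] := idealP I.
apply/quot_piP; set a' := repr _; set b' := repr _.
have -> : a' * b' - a * b = (a' - a) * b' + a * (b' - b).
  by rewrite mulrBl mulrBr addrA subrK.
by apply: ID; [apply: Ir | apply: Il]; apply: quot_repr.
Qed.

Lemma quot_scaleE k a : quot_scale k (quot_pi a) = quot_pi (k *: a).
Proof.
have [_ ID Il Ir] := idealP I.
apply/quot_piP; rewrite -scalerBr -[X in k *: X]mul1r scalerAl.
by apply: Il; apply: quot_repr.
Qed.

Ltac reprs :=
  repeat (let x := fresh "x" in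
    move=> x; let E := fresh "E" in have [? E] := quot_piS x; rewrite {x}E).

Lemma quot_mulA : associative quot_mul.
Proof. by reprs; rewrite !quot_mulE mulrA. Qed.
Lemma quot_mul1 : left_id quot_one quot_mul.
Proof. by reprs; rewrite quot_mulE mul1r. Qed.
Lemma quot_mulr1 : right_id quot_one quot_mul.
Proof. by reprs; rewrite quot_mulE mulr1. Qed.
Lemma quot_mulDl : left_distributive quot_mul +%R.
Proof. by reprs; rewrite -quot_piD !quot_mulE -quot_piD mulrDl. Qed.
Lemma quot_mulDr : right_distributive quot_mul +%R.
Proof. by reprs; rewrite -quot_piD !quot_mulE -quot_piD mulrDr. Qed.
Lemma quot_one_neq0 : quot_one != 0.
Proof.
apply/eqP; rewrite -(subrr (quot_pi 0)) -quot_piB subrr => /quot_piP.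
by rewrite subr0; apply: ideal_proper.
Qed.
HB.instance Definition _ := GRing.Zmodule_isNzRing.Build quot_alg
  quot_mulA quot_mul1 quot_mulr1 quot_mulDl quot_mulDr quot_one_neq0.

Lemma quot_scaleA k l x : quot_scale k (quot_scale l x) = quot_scale (k * l) x.
Proof. by have [a ->] := quot_piS x; rewrite !quot_scaleE scalerA. Qed.
Lemma quot_scale1 : left_id 1 quot_scale.
Proof. by reprs; rewrite quot_scaleE scale1r. Qed.
Lemma quot_scaleDr : right_distributive quot_scale +%R.
Proof.
by move=> k; reprs; rewrite -quot_piD !quot_scaleE -quot_piD scalerDr.
Qed.
Lemma quot_scaleDl x : {morph quot_scale^~ x : k l / k + l}.
Proof.
by have [a ->] := quot_piS x => k l; rewrite !quot_scaleE -quot_piD scalerDl.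
Qed.
HB.instance Definition _ := GRing.Zmodule_isLmodule.Build F quot_alg
  quot_scaleA quot_scale1 quot_scaleDr quot_scaleDl.

Lemma quot_scaleAl k (x y : quot_alg) : k *: (x * y) = (k *: x) * y.
Proof.
have [a ->] := quot_piS x; have [b ->] := quot_piS y.
rewrite /GRing.scale /GRing.mul /=.
by rewrite !(quot_scaleE, quot_mulE) scalerAl.
Qed.
HB.instance Definition _ := GRing.Lmodule_isLalgebra.Build F quot_alg
  quot_scaleAl.

Lemma quot_scaleAr k (x y : quot_alg) : k *: (x * y) = x * (k *: y).
Proof.
have [a ->] := quot_piS x; have [b ->] := quot_piS y.
rewrite /GRing.scale /GRing.mul /=.
by rewrite !(quot_scaleE, quot_mulE) scalerAr.
Qed.
HB.instance Definition _ := GRing.Lalgebra_isAlgebra.Build F quot_alg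
  quot_scaleAr.

Lemma quot_pi_linear : linear quot_pi.
Proof. by move=> k a b; rewrite quot_piD -quot_scaleE. Qed.
HB.instance Definition _ := GRing.isLinear.Build F A quot_alg _ quot_pi
  quot_pi_linear.

Lemma quot_pi_monoid : monoid_morphism quot_pi.
Proof. by split=> // a b; rewrite -quot_mulE. Qed.
HB.instance Definition _ := GRing.isMonoidMorphism.Build A quot_alg quot_pi
  quot_pi_monoid.
End QuotientAlgebra.

Section SeqAlgebra.
Variables (X : Type) (F : fieldType).
Implicit Types f g h : seq X -> F.

Definition bounded_deg : {pred (seq X -> F)} :=
  fun f => `[< exists N, forall s, (N <= size s)%N -> f s = 0 >].

Lemma bounded_deg_zmod : zmod_closed bounded_deg.
Proof.
split=> [|f g /asboolP[M fM] /asboolP[N gN]]; apply/asboolP; first by exists 0%N.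
exists (maxn M N) => s; rewrite geq_max => /andP[sM sN].
by rewrite /GRing.add /GRing.opp /= fM // gN // subr0.
Qed.

(* The direct sum over n of the spaces Map(X^n, F): the restriction of
   f : seqalg to the sequences of size n is its component of degree n. The
   product is (f * g)(x_1, .., x_n)
     = \sum_(0 <= i <= n) f(x_1, .., x_i) * g(x_{i+1}, .., x_n).
   If X is finite this is the tensor algebra of the space F^X, the word
   x_1 .. x_n corresponding to the basis vector x_1 (x) .. (x) x_n. If X is a
   group G it is the algebra of inhomogeneous (bar) cochains of G with
   coefficients in F, with the cup product. *)
Record seqalg := SeqAlg { seqfun :> seq X -> F; _ : bounded_deg seqfun }.

HB.instance Definition _ := [isSub for seqfun].
HB.instance Definition _ := [Choice of seqalg by <:].
HB.instance Definition _ := GRing.SubChoice_isSubZmodule.Build (seq X -> F)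
  bounded_deg seqalg bounded_deg_zmod.

Definition seq_one : seq X -> F := fun s => (nilp s)%:R.

Definition seq_mul f g : seq X -> F :=
  fun s => \sum_(i < (size s).+1) f (take i s) * g (drop i s).

Lemma seq_mul_nil f g : seq_mul f g [::] = f [::] * g [::].
Proof. by rewrite /seq_mul big_ord_recl big_ord0 addr0. Qed.

Lemma seq_mul_cons f g x s :
  seq_mul f g (x :: s) =
  f [::] * g (x :: s) + seq_mul (fun t => f (x :: t)) g s.
Proof. by rewrite /seq_mul big_ord_recl. Qed.

Lemma seq_mulDl f f' g s :
  seq_mul (fun t => f t + f' t) g s = seq_mul f g s + seq_mul f' g s.
Proof. by rewrite -big_split; apply: eq_bigr => i _ /=; rewrite mulrDl. Qed.

Lemma seq_mulDr f g g' s :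
  seq_mul f (fun t => g t + g' t) s = seq_mul f g s + seq_mul f g' s.
Proof. by rewrite -big_split; apply: eq_bigr => i _ /=; rewrite mulrDr. Qed.

Lemma seq_mulZl k f g s : seq_mul (fun t => k * f t) g s = k * seq_mul f g s.
Proof. by rewrite mulr_sumr; apply: eq_bigr => i _ /=; rewrite mulrA. Qed.

Lemma seq_mulZr k f g s : seq_mul f (fun t => k * g t) s = k * seq_mul f g s.
Proof. by rewrite mulr_sumr; apply: eq_bigr => i _ /=; rewrite mulrCA. Qed.

Lemma eq_seq_mul f f' g g' : f =1 f' -> g =1 g' -> seq_mul f g =1 seq_mul f' g'.
Proof. by move=> Ef Eg s; apply: eq_bigr => i _; rewrite Ef Eg. Qed.

Lemma seq_mul1 f s : seq_mul seq_one f s = f s.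
Proof.
case: s => [|x s]; first by rewrite seq_mul_nil /seq_one mul1r.
rewrite seq_mul_cons /seq_one mul1r /seq_mul big1 ?addr0 // => i _.
by rewrite mul0r.
Qed.

Lemma seq_mulr1 f s : seq_mul f seq_one s = f s.
Proof.
elim: s f => [|x s IHs] f; first by rewrite seq_mul_nil /seq_one mulr1.
by rewrite seq_mul_cons IHs /seq_one mulr0 add0r.
Qed.

Lemma seq_mulA f g h s :
  seq_mul f (seq_mul g h) s = seq_mul (seq_mul f g) h s.
Proof.
elim: s f g => [|x s IHs] f g; first by rewrite !seq_mul_nil mulrA.
rewrite seq_mul_cons IHs [in RHS]seq_mul_cons seq_mul_nil.
under [in RHS]eq_seq_mul do [rewrite seq_mul_cons|].
rewrite seq_mulDl seq_mulZl seq_mul_cons mulrDr !addrA; congr (_ + _).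
by rewrite mulrA.
Qed.

Lemma bounded_one : bounded_deg seq_one.
Proof. by apply/asboolP; exists 1%N => -[]. Qed.

Lemma bounded_mul (f g : seqalg) : bounded_deg (seq_mul f g).
Proof.
case: f g => [f /[dup] fP /asboolP[M fM]] [g /[dup] gP /asboolP[N gN]] /=.
apply/asboolP; exists (M + N)%N => s sMN; apply: big1 => i _.
have [le_i|lt_i] := leqP M i.
  have i_s : (i <= size s)%N by rewrite -ltnS.
  by rewrite fM ?mul0r // size_takel.
rewrite gN ?mulr0 // size_drop (leq_trans _ (leq_sub2r i sMN)) //.
by rewrite -addnBAC ?leq_addl // ltnW.
Qed.

Definition seqalg_one : seqalg := SeqAlg bounded_one.
Definition seqalg_mul (f g : seqalg) : seqalg := SeqAlg (bounded_mul f g).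

Lemma seqalgP (f g : seqalg) : (f : seq X -> F) =1 g -> f = g.
Proof. by move=> fg; apply: val_inj; apply/funext. Qed.

Lemma seqalg_mulA : associative seqalg_mul.
Proof. by move=> f g h; apply: seqalgP => s; apply: seq_mulA. Qed.
Lemma seqalg_mul1 : left_id seqalg_one seqalg_mul.
Proof. by move=> f; apply: seqalgP => s; apply: seq_mul1. Qed.
Lemma seqalg_mulr1 : right_id seqalg_one seqalg_mul.
Proof. by move=> f; apply: seqalgP => s; apply: seq_mulr1. Qed.
Lemma seqalg_mulDl : left_distributive seqalg_mul +%R.
Proof. by move=> f g h; apply: seqalgP => s; apply: seq_mulDl. Qed.
Lemma seqalg_mulDr : right_distributive seqalg_mul +%R.
Proof. by move=> f g h; apply: seqalgP => s; apply: seq_mulDr. Qed.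
Lemma seqalg_one_neq0 : seqalg_one != 0.
Proof.
apply/eqP => /(congr1 (fun f : seqalg => f [::])) /eqP.
by rewrite /= /seq_one oner_eq0.
Qed.
HB.instance Definition _ := GRing.Zmodule_isNzRing.Build seqalg
  seqalg_mulA seqalg_mul1 seqalg_mulr1 seqalg_mulDl seqalg_mulDr
  seqalg_one_neq0.

Lemma bounded_scale k (f : seqalg) : bounded_deg (fun s => k * f s).
Proof.
case: f => [f fP]; move/asboolP: (fP) => [N fN].
by apply/asboolP; exists N => s sN /=; rewrite fN // mulr0.
Qed.

Definition seqalg_scale k (f : seqalg) : seqalg := SeqAlg (bounded_scale k f).

Lemma seqalg_scaleA k l (f : seqalg) :
  seqalg_scale k (seqalg_scale l f) = seqalg_scale (k * l) f.
Proof. by apply: seqalgP => s; apply: mulrA. Qed.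
Lemma seqalg_scale1 : left_id 1 seqalg_scale.
Proof. by move=> f; apply: seqalgP => s; apply: mul1r. Qed.
Lemma seqalg_scaleDr : right_distributive seqalg_scale +%R.
Proof. by move=> k f g; apply: seqalgP => s; apply: mulrDr. Qed.
Lemma seqalg_scaleDl (f : seqalg) : {morph seqalg_scale^~ f : k l / k + l}.
Proof. by move=> k l; apply: seqalgP => s; apply: mulrDl. Qed.
HB.instance Definition _ := GRing.Zmodule_isLmodule.Build F seqalg
  seqalg_scaleA seqalg_scale1 seqalg_scaleDr seqalg_scaleDl.

Lemma seqalg_scaleAl k (f g : seqalg) : k *: (f * g) = (k *: f) * g.
Proof. by apply: seqalgP => s; apply/esym/seq_mulZl. Qed.
HB.instance Definition _ := GRing.Lmodule_isLalgebra.Build F seqalg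
  seqalg_scaleAl.

Lemma seqalg_scaleAr k (f g : seqalg) : k *: (f * g) = f * (k *: g).
Proof. by apply: seqalgP => s; apply/esym/seq_mulZr. Qed.
HB.instance Definition _ := GRing.Lalgebra_isAlgebra.Build F seqalg
  seqalg_scaleAr.

Definition homog (n : nat) : set seqalg :=
  [set f | forall s, size s != n -> f s = 0].

End SeqAlgebra.

Definition is_grading (F : fieldType) (A : algType F) (gr : nat -> set A) : Prop :=
  [/\ forall n, is_subspace (gr n),
      gr 0%N 1,
      forall m n a b, gr m a -> gr n b -> gr (m + n)%N (a * b),
      forall a, exists (N : nat) (c : nat -> A),
        (forall n, gr n (c n)) /\ a = \sum_(n < N) c n &
      forall (N : nat) (c : nat -> A), (forall n, gr n (c n)) ->
        \sum_(n < N) c n = 0 -> forall n, (n < N)%N -> c n = 0].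

Record gralgType (F : fieldType) := GrAlg {
  gralg_sort :> algType F;
  grpart : nat -> set gralg_sort;
  gralgP : is_grading grpart }.
Arguments grpart {F} A n : rename.

Section Quadratic.
Variable F : fieldType.

(* T(V) for V = F^d, with the basis of words in the basis vectors of V. *)
Definition tensor_alg (d : nat) : algType F := seqalg 'I_d F.

Record quad_rels (d : nat) := QuadRels {
  rels :> set (tensor_alg d);
  rels_subspace : is_subspace rels;
  rels_deg2 : rels `<=` @homog 'I_d F 2 }.

Lemma quad_ideal_proper d (Om : quad_rels d) : ~ ideal_gen Om 1.
Proof.
move=> Om1; pose I := [set f : seqalg 'I_d F | f [::] = 0].
suff: I 1 by move/eqP; rewrite /= /seq_one /= oner_eq0.
apply: Om1; last by move=> f Omf; apply: (rels_deg2 Omf).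
split=> [|f g f0 g0|f g g0|f g f0]; rewrite /I /= ?seq_mul_nil.
- by [].
- by rewrite [LHS](_ : _ = f [::] + g [::]) // f0 g0 addr0.
- by rewrite g0 mulr0.
- by rewrite f0 mul0r.
Qed.

Definition quad_ideal d (Om : quad_rels d) : proper_ideal (tensor_alg d) :=
  ProperIdeal (ideal_gen_ideal Om) (@quad_ideal_proper d Om).

Definition quadratic (A : gralgType F) : Prop :=
  exists (d : nat) (Om : quad_rels d)
         (phi : {lrmorphism quot_alg (quad_ideal Om) -> A}),
    bijective phi /\
    forall n, phi @` (quot_pi (quad_ideal Om) @` @homog 'I_d F n) = grpart A n.

(* The indices idx 0, .., idx (k - 1) are the i_1, .., i_k of the usual
   definition and idx r is i_{r + 1}, so that the range 1, .., k - 1 of the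
   usual one-based r becomes r.+1 < k. *)
Definition strongly_koszul (A : gralgType F) : Prop :=
  quadratic A /\
  exists (d : nat) (u : 'I_d -> A),
    is_basis (grpart A 1) u /\
    forall (k : nat) (idx : 'I_k -> 'I_d), injective idx ->
    forall r : 'I_k, (r.+1 < k)%N ->
    exists Y : set 'I_d,
      colon (ideal_gen [set u (idx j) | j in [set j : 'I_k | (j < r)%N]])
            (ideal_gen [set u (idx r)])
      = ideal_gen (u @` Y).
End Quadratic.

Section Cohomology.
Variables (G : groupType) (F : fieldType).
Implicit Types (f g : seq G -> F) (a b : seqalg G F).

(* merge i (g_0, .., g_n) = (g_0, .., g_i * g_{i+1}, .., g_n) *)
Fixpoint merge (i : nat) (s : seq G) : seq G :=
  if s is x :: t then
    if i is j.+1 then x :: merge j t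
    else if t is y :: u then (x * y)%g :: u else s
  else [::].

(* The inhomogeneous coboundary for the trivial action of G on F
     (df)(g_1, .., g_n) = f(g_2, .., g_n)
       + \sum_(1 <= i < n) (-1)^i f(g_1, .., g_i g_{i+1}, .., g_n)
       + (-1)^n f(g_1, .., g_{n-1}). *)
Definition cobound_fun f : seq G -> F := fun s =>
  if s is x :: t then
    f t + \sum_(i < size t) (-1) ^+ i.+1 * f (merge i s)
      + (-1) ^+ size s * f (belast x t)
  else 0.

(* cobound_fun f (x :: t) = f t - cob_tail f x t *)
Definition cob_tail f (x : G) (t : seq G) : F :=
  \sum_(i < size t) (-1) ^+ i * f (merge i (x :: t))
    + (-1) ^+ size t * f (belast x t).

Lemma cobound_cons f x t : cobound_fun f (x :: t) = f t - cob_tail f x t.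
Proof.
rewrite /= /cob_tail opprD -addrA; congr (_ + (_ + _)).
  by rewrite -sumrN; apply: eq_bigr => i _; rewrite exprS mulN1r mulNr.
by rewrite exprS mulN1r mulNr.
Qed.

Lemma cob_tail_nil f x : cob_tail f x [::] = f [::].
Proof. by rewrite /cob_tail big_ord0 add0r mul1r. Qed.

Lemma cob_tail_cons f x y t :
  cob_tail f x (y :: t) = f ((x * y)%g :: t) - cob_tail (fun s => f (x :: s)) y t.
Proof.
rewrite /cob_tail big_ord_recl /= mul1r opprD -addrA; congr (_ + (_ + _)).
  by rewrite -sumrN; apply: eq_bigr => i _; rewrite exprS mulN1r mulNr.
by rewrite exprS mulN1r mulNr.
Qed.

Lemma cob_tail_lin k f g x t :
  cob_tail (fun s => k * f s + g s) x t = k * cob_tail f x t + cob_tail g x t.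
Proof.
elim: t x f g => [|y t IHt] x f g; first by rewrite !cob_tail_nil.
by rewrite !cob_tail_cons IHt mulrBr opprD addrACA.
Qed.

Lemma eq_cob_tail f g x t : f =1 g -> cob_tail f x t = cob_tail g x t.
Proof.
move=> fg; rewrite /cob_tail fg; congr (_ + _).
by apply: eq_bigr => i _; rewrite fg.
Qed.

Lemma cob_tailB f g x t :
  cob_tail (fun s => f s - g s) x t = cob_tail f x t - cob_tail g x t.
Proof.
rewrite (@eq_cob_tail _ (fun s => -1 * g s + f s)) => [|s].
  by rewrite cob_tail_lin mulN1r addrC.
by rewrite mulN1r addrC.
Qed.

Lemma cob_tail2 f x y t :
  cob_tail (cob_tail f x) y t = cob_tail f (x * y)%g t.
Proof.
elim: t f x y => [|z t IHt] f x y; first by rewrite !cob_tail_nil.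
rewrite cob_tail_cons.
rewrite (@eq_cob_tail (fun s => cob_tail f x (y :: s))
  (fun s => f ((x * y)%g :: s) - cob_tail (fun s => f (x :: s)) y s)); last first.
  by move=> s; rewrite cob_tail_cons.
rewrite cob_tailB IHt !cob_tail_cons mulgA; ring.
Qed.

Lemma cobound2_fun f s : cobound_fun (cobound_fun f) s = 0.
Proof.
case: s => [//|x [|y t]].
  by rewrite cobound_cons cob_tail_nil subrr.
rewrite 2!cobound_cons cob_tail_cons.
rewrite (@eq_cob_tail (fun s => cobound_fun f (x :: s))
  (fun s => f s - cob_tail f x s)); last by move=> s; rewrite cobound_cons.
rewrite cob_tailB cob_tail2 !cobound_cons; ring.
Qed.

Definition seq_sign f : seq G -> F := fun s => (-1) ^+ size s * f s.

Lemma cob_tail_mul f g x t :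
  cob_tail (seq_mul f g) x t =
  seq_mul (cob_tail f x) g t - seq_mul (seq_sign f) (cobound_fun g) (x :: t).
Proof.
elim: t x f => [|y t IHt] x f.
  rewrite cob_tail_nil seq_mul_cons !seq_mul_nil cob_tail_nil cobound_cons.
  by rewrite cob_tail_nil subrr /= !mulr0 addr0 subr0.
rewrite cob_tail_cons (@eq_cob_tail _ (fun s => f [::] * g (x :: s) +
  seq_mul (fun s => f (x :: s)) g s)); last by move=> s; rewrite seq_mul_cons.
rewrite cob_tail_lin IHt !seq_mul_cons !cobound_cons !cob_tail_cons !cob_tail_nil.
have -> : seq_mul (fun s => cob_tail f x (y :: s)) g t =
  seq_mul (fun s => f ((x * y)%g :: s)) g t
  - seq_mul (cob_tail (fun s => f (x :: s)) y) g t.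
  rewrite (@eq_seq_mul _ _ _ (fun s => -1 * cob_tail (fun s => f (x :: s)) y s
    + f ((x * y)%g :: s)) g g) => // [|s].
    by rewrite seq_mulDl seq_mulZl mulN1r addrC.
  by rewrite cob_tail_cons mulN1r addrC.
have -> : seq_mul (fun s => seq_sign f [:: x, y & s]) (cobound_fun g) t =
  - seq_mul (fun s => seq_sign (fun s => f (x :: s)) (y :: s)) (cobound_fun g) t.
  rewrite -mulN1r -seq_mulZl; apply: eq_seq_mul => // s.
  by rewrite /seq_sign /= exprS mulrA.
rewrite /seq_sign /= expr0 expr1 !mul1r.
set a := seq_mul _ _ _; set b := seq_mul _ _ _; set c := seq_mul _ _ _.
ring.
Qed.

Lemma cobound_mul_fun f g s :
  cobound_fun (seq_mul f g) s =
  seq_mul (cobound_fun f) g s + seq_mul (seq_sign f) (cobound_fun g) s.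
Proof.
case: s => [|x t]; first by rewrite !seq_mul_nil /= mul0r mulr0 addr0.
rewrite cobound_cons cob_tail_mul [seq_mul (cobound_fun f) g _]seq_mul_cons.
rewrite (@eq_seq_mul _ _ (fun s => cobound_fun f (x :: s))
  (fun s => -1 * cob_tail f x s + f s) g g) => // [|u].
  by rewrite (seq_mulDl (fun s => -1 * cob_tail f x s) f) seq_mulZl /=; ring.
by rewrite cobound_cons; ring.
Qed.

Lemma cobound_sign f s : cobound_fun (seq_sign f) s = - seq_sign (cobound_fun f) s.
Proof.
case: s => [|x t]; first by rewrite /seq_sign /= mulr0 oppr0.
rewrite {2}/seq_sign !cobound_cons.
suff -> : cob_tail (seq_sign f) x t = (-1) ^+ size t * cob_tail f x t.
  by rewrite /seq_sign /= exprS; ring.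
elim: t x f => [|y t IHt] x f; first by rewrite !cob_tail_nil /seq_sign.
rewrite !cob_tail_cons (@eq_cob_tail (fun s => seq_sign f (x :: s))
  (fun s => -1 * seq_sign (fun s => f (x :: s)) s + 0)) => [|s].
  rewrite cob_tail_lin IHt [cob_tail (fun=> 0) _ _](_ : _ = 0) /seq_sign /=.
    by rewrite exprS; ring.
  by rewrite /cob_tail big1 ?mulr0 ?addr0 // => i _; rewrite mulr0.
by rewrite /seq_sign /= exprS; ring.
Qed.

Lemma size_merge i s : (i.+1 < size s)%N -> size (merge i s) = (size s).-1.
Proof.
elim: s i => [|x t IHt] [|i] //=; first by case: t {IHt}.
by rewrite ltnS => it; rewrite /= IHt // prednK // (leq_ltn_trans _ it).
Qed.

(* The values of cobound_fun f on sequences of size n.+1 only depend on those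
   of f on sequences of size n. *)
Lemma cobound_local f g n s : size s = n.+1 ->
  (forall t, size t = n -> f t = g t) -> cobound_fun f s = cobound_fun g s.
Proof.
case: s => [//|x t] /= [szt] fg.
rewrite !fg ?size_belast //; congr (_ + _ + _).
apply: eq_bigr => i _; rewrite fg // -szt.
by rewrite (@size_merge i (x :: t)) //= ltnS.
Qed.

Lemma cobound0_fun s : cobound_fun (fun=> 0) s = 0.
Proof.
case: s => [//|x t]; rewrite /= mulr0 addr0 add0r.
by apply: big1 => i _; rewrite mulr0.
Qed.

Lemma bounded_cobound (f : seqalg G F) : bounded_deg (cobound_fun f).
Proof.
case: f => [f fP] /=; move/asboolP: (fP) => [N fN].
apply/asboolP; exists N.+1 => -[//|x t] /= szt.
rewrite -/(cobound_fun f (x :: t)) -(cobound0_fun (x :: t)).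
apply: (@cobound_local _ _ (size t)) => // u szu.
by apply: fN; rewrite szu.
Qed.

Lemma bounded_sign (f : seqalg G F) : bounded_deg (seq_sign f).
Proof.
case: f => [f fP] /=; move/asboolP: (fP) => [N fN].
by apply/asboolP; exists N => s szs; rewrite /seq_sign fN // mulr0.
Qed.

Definition cobound (f : seqalg G F) : seqalg G F := SeqAlg (bounded_cobound f).
Definition sign (f : seqalg G F) : seqalg G F := SeqAlg (bounded_sign f).

Lemma cobound_is_linear : linear cobound.
Proof.
move=> k f g; apply: seqalgP => -[|x t].
  by rewrite -[RHS]/(k * 0 + 0) mulr0 addr0.
rewrite -[LHS]/(cobound_fun (fun s => k * f s + g s) (x :: t)).
rewrite -[RHS]/(k * cobound_fun f (x :: t) + cobound_fun g (x :: t)).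
by rewrite !cobound_cons cob_tail_lin; ring.
Qed.
HB.instance Definition _ := GRing.isLinear.Build F (seqalg G F) (seqalg G F) _
  cobound cobound_is_linear.

Lemma cobound2 a : cobound (cobound a) = 0.
Proof. by apply: seqalgP => s; apply: cobound2_fun. Qed.

Lemma coboundM a b : cobound (a * b) = cobound a * b + sign a * cobound b.
Proof. by apply: seqalgP => s; apply: cobound_mul_fun. Qed.

Lemma cobound_signE a : cobound (sign a) = - sign (cobound a).
Proof. by apply: seqalgP => s; apply: cobound_sign. Qed.

Lemma signK a : sign (sign a) = a.
Proof.
apply: seqalgP => s; rewrite /= /seq_sign mulrA -exprD addnn -mul2n.
by rewrite exprM sqrrN !expr1n mul1r.
Qed.

Lemma sign0 : sign 0 = 0.
Proof. by apply: seqalgP => s; rewrite /= /seq_sign mulr0. Qed.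

Lemma cobound1 : cobound 1 = 0.
Proof.
apply: seqalgP => -[|x [|y t]] //; rewrite -[LHS]/(cobound_fun _ _).
  by rewrite cobound_cons cob_tail_nil subrr.
rewrite -[RHS](cobound0_fun [:: x, y & t]).
apply: (@cobound_local _ _ (size t).+1) => // -[//|z u] _.
by [].
Qed.

Definition is_cocycle : {pred seqalg G F} := fun a => cobound a == 0.

Lemma cocycle_subalg : subalg_closed is_cocycle.
Proof.
split=> [|k f g /eqP df /eqP dg|f g /eqP df /eqP dg]; apply/eqP.
- exact: cobound1.
- by rewrite cobound_is_linear df dg scaler0 addr0.
- by rewrite coboundM df dg mul0r mulr0 addr0.
Qed.

Record cocycle := Cocycle { cocycle_val :> seqalg G F; _ : is_cocycle cocycle_val }.

HB.instance Definition _ := [isSub for cocycle_val].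
HB.instance Definition _ := [Choice of cocycle by <:].
HB.instance Definition _ := GRing.SubChoice_isSubAlgebra.Build F (seqalg G F)
  is_cocycle cocycle cocycle_subalg.

Definition coboundaries : set cocycle :=
  [set z | exists f : seqalg G F, val z = cobound f].

Lemma coboundaries_ideal : is_ideal coboundaries.
Proof.
split.
- by exists 0; rewrite [RHS]linear0.
- by move=> y z [f yf] [g zg]; exists (f + g); rewrite [RHS]linearD /= -yf -zg.
- move=> y z [g zg]; exists (sign (val y) * g).
  rewrite rmorphM /= zg coboundM cobound_signE signK.
  have /eqP -> : is_cocycle (val y) by exact: valP.
  by rewrite sign0 oppr0 mul0r add0r.
- move=> y z [f yf]; exists (f * val z).
  have /eqP dz : is_cocycle (val z) by exact: valP.
  by rewrite rmorphM /= yf coboundM dz mulr0 addr0.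
Qed.

Lemma coboundaries_proper : ~ coboundaries 1.
Proof.
case=> f /(congr1 (fun h : seqalg G F => h [::])) /eqP.
by rewrite /= /seq_one /= oner_eq0.
Qed.

Definition cobound_ideal : proper_ideal cocycle :=
  ProperIdeal coboundaries_ideal coboundaries_proper.

Definition cohom_alg : algType F := quot_alg cobound_ideal.

(* cohom_alg is Z / B for the total complex, the direct sum over n of the
   Map(G^n, F). As cobound is homogeneous of degree 1, it is the direct sum of
   the H^n(G, F) (see cohom_grading), where H^n(G, F) consists of the classes
   of the cocycles of degree n. *)
Definition cohom (n : nat) : set cohom_alg :=
  quot_pi cobound_ideal @` [set z | homog n (val z)].

Lemma bounded_part n a : bounded_deg (fun s => if size s == n then a s else 0).
Proof.
by apply/asboolP; exists n.+1 => s; case: eqP => // ->; rewrite ltnn.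
Qed.

Definition part n a : seqalg G F := SeqAlg (bounded_part n a).

Lemma homog_part n a : homog n (part n a).
Proof. by move=> s /negPf ns; rewrite /= ns. Qed.

Lemma part_homog m n a : homog m a -> part n a = if m == n then a else 0.
Proof.
move=> ma; apply: seqalgP => s; rewrite /=; case: eqP => [<-|/eqP ns].
  by case: eqP => // /eqP ms; rewrite ma // eq_sym.
by case: eqP => // mn; rewrite ma // mn.
Qed.

Lemma part_sum n N (c : nat -> seqalg G F) :
  part n (\sum_(m < N) c m) = \sum_(m < N) part n (c m).
Proof.
elim: N => [|N IHN].
  by rewrite !big_ord0; apply: seqalgP => s; rewrite /=; case: eqP.
rewrite !big_ord_recr /= -IHN; apply: seqalgP => s.
rewrite -[RHS]/(part n _ s + part n _ s) /=.
by case: eqP => // _; rewrite addr0.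
Qed.

Lemma sum_part a : exists N, a = \sum_(n < N) part n a.
Proof.
case: a => [f fP]; move/asboolP: (fP) => [N fN]; exists N.
apply: seqalgP => s; set a := SeqAlg _.
have evE M : (\sum_(n < M) part n a) s = \sum_(n < M) (part n a s).
  by elim: M => [|M IHM]; rewrite ?big_ord0 // !big_ord_recr -IHM.
rewrite evE /=; have [lt_s|/fN fs0] := ltnP (size s) N.
  rewrite (bigD1 (Ordinal lt_s)) //= eqxx big1 ?addr0 // => i.
  by rewrite -val_eqE eq_sym => /negPf /= ->.
by rewrite fs0 big1 // => i _; rewrite if_same.
Qed.

Lemma cobound_part n a : cobound (part n a) = part n.+1 (cobound a).
Proof.
apply: seqalgP => -[//|x t].
rewrite -[LHS]/(cobound_fun _ _) -[RHS]/(if _ then cobound_fun a (x :: t) else 0).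
case: ifP => szt.
  apply: (@cobound_local _ _ n) => [|u szu]; first exact/eqP.
  by rewrite /= szu eqxx.
rewrite -[RHS](cobound0_fun (x :: t)); apply: (@cobound_local _ _ (size t)) => //.
by move=> u szu /=; rewrite szu -eqSS [_ == _]szt.
Qed.

Lemma part0_cobound a : part 0 (cobound a) = 0.
Proof. by apply: seqalgP => -[]. Qed.

Lemma cocycle_part n (z : cocycle) : is_cocycle (part n (val z)).
Proof.
rewrite /is_cocycle cobound_part.
have /eqP -> : is_cocycle (val z) by exact: valP.
by apply/eqP/seqalgP => s /=; rewrite if_same.
Qed.

Lemma cohom_grading : is_grading cohom.
Proof.
split=> [n|||x|N c cP c0 n nN].
- split=> [|k x y [y1 hy1 <-] [z hz <-]].
    by exists 0; rewrite ?linear0 // => s _; rewrite linear0.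
  exists (k *: y1 + z); last by rewrite linearP.
  by move=> s ns; rewrite linearP -[LHS]/(k * val y1 s + val z s) hy1 // hz // mulr0 addr0.
- by exists 1; [case | rewrite rmorph1].
- move=> m n x y [y1 hy1 <-] [z hz <-]; exists (y1 * z); last by rewrite rmorphM.
  move=> s smn; rewrite rmorphM; apply: big1 => i _.
  have [sm|sm] := eqVneq (size (take i s)) m; last by rewrite hy1 // mul0r.
  have [sn|sn] := eqVneq (size (drop i s)) n; last by rewrite hz // mulr0.
  by case/eqP: smn; rewrite -(cat_take_drop i s) size_cat sm sn.
- have [z ->] := quot_piS x; have [N zN] := sum_part (val z).
  exists N, (fun n => quot_pi cobound_ideal (Cocycle (cocycle_part n z))).
  split=> [n|]; first by exists (Cocycle (cocycle_part n z)) => //; apply: homog_part.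
  rewrite -linear_sum; congr quot_pi.
  by apply: val_inj; rewrite [RHS]linear_sum.
have /choice [z zP] : forall m, exists z : cocycle,
    homog m (val z) /\ quot_pi cobound_ideal z = c m.
  by move=> m; have [z hz <-] := cP m; exists z.
have : quot_pi cobound_ideal (\sum_(m < N) z m) = quot_pi cobound_ideal 0.
  rewrite linear_sum linear0 -[RHS]c0.
  by apply: eq_bigr => m _; case: (zP m).
move=> /quot_piP; rewrite subr0 => -[b zb].
rewrite -(zP n).2 -(linear0 (quot_pi cobound_ideal)); apply/quot_piP.
rewrite subr0; have {}zb : val (z n) = part n (cobound b).
  rewrite -zb linear_sum (@part_sum n N (fun m => val (z m))).
  rewrite (bigD1 (Ordinal nN)) //= (part_homog _ (zP n).1) eqxx.
  rewrite big1 ?addr0 // => i /negPf; rewrite -val_eqE /= => ni.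
  by rewrite (part_homog _ (zP i).1) ni.
case: n {nN} zb => [|n] zb; last by exists (part n b); rewrite cobound_part.
by exists 0; rewrite zb part0_cobound [RHS]linear0.
Qed.

Definition cohomology : gralgType F := GrAlg cohom_grading.
End Cohomology.

(* Main.v *)
Require Import Defs.
From HB Require Import structures.
From mathcomp Require Import all_boot all_order all_algebra.
From mathcomp Require Import ring.
From mathcomp Require Import boolp classical_sets functions.

Set Implicit Arguments.
Unset Strict Implicit.
Unset Printing Implicit Defensive.

Import GRing.Theory.

Local Open Scope ring_scope.

(** The group cohomology of G = G_Gamma is computed first, and the strong
Koszul property is then read off from a basis of monomials.

The answer. For a vertex v let chi_v : G -> F be the homomorphism counting the
exponent of v, and u_v its class in degree 1. The u_v anticommute, and u_v u_w
= 0 as soon as v and w are not adjacent; this includes v = w, so that squares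
vanish in characteristic 2 too. The products of the u_v over the cliques of
Gamma, called faces below, form a basis of the cohomology: it is the exterior
face algebra of the clique complex.

From the basis to strong Koszulity. An ideal generated by a set Y of u_v is
spanned by the faces that meet Y, and multiplying a face C by u_r gives zero
or, up to sign, the face of C and r. Comparing coordinates, the colon ideal
(Y) : (u_r) is generated by Y and the u_v with v not adjacent to r
(colon_gens). The algebra presented by the relations of degree 2 is spanned by
its faces for the same reason, and these map to linearly independent elements
of the cohomology, which is therefore quadratic (exterior_quadratic).

Relations. The pointwise product of chi_v and chi_w is a primitive of the
anticommutator. If v and w are not adjacent, G maps to the Heisenberg group by
sending v and w to the two standard generators, and the central coordinate is
a primitive of chi_v chi_w.

Independence. Killing the vertices outside a clique of minimal size in a
linear relation isolates one monomial. It is not a coboundary, because the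
slant product with a vertex t of the clique removes the factor chi_t and
commutes with the coboundary up to sign, so that one can strip the factors one
by one (hword_nonexact).

Spanning (cocycle_cup_generated). Let G_S be the subgroup generated by a set S
of vertices, t a vertex of S, T the rest of S and L the neighbours of t in T.
Then G_S is the HNN extension of G_T in which the stable letter t centralizes
G_L. Subtracting from a cocycle its restriction to G_T, and then the product
of chi_t with its slant product by t, both of which are generated by the chi_v
by induction, leaves a cocycle that vanishes on G_T and has zero slant product
with t on G_L. Such a cocycle is a coboundary (slant_kernel_exact). This last
fact is a Mayer-Vietoris argument made explicit on cochains in homogeneous
coordinates: every G_S is a retract of G, a retraction induces a homotopy that
is equivariant under G_S, and the acyclicity of the Bass-Serre tree is
replaced by the universal property of the presentation, used to build an
action of G on pairs of a tuple and a scalar (primitive_translate). *)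

(** * Homogeneous cochains and prism homotopies *)

Section HomogeneousCochains.
Variables (X : Type) (F : fieldType).
Implicit Types (f g : seq X -> F) (s t : seq X) (a b c : X -> X).

(** The alternating sum of the values of f on the sequences obtained from s by
omitting one entry. The empty sequence counts as a simplex of dimension -1:
the complex is augmented. *)
Fixpoint hcob f s : F :=
  if s is x :: t then f t - hcob (fun u => f (x :: u)) t else 0.

(** The alternating sum over i of f (a x_0, .., a x_i, b x_i, .., b x_n). *)
Fixpoint prism a b f s : F :=
  if s is x :: t then
    f (a x :: b x :: map b t) - prism a b (fun u => f (a x :: u)) t
  else 0.

Lemma hcob_cons f x t :
  hcob f (x :: t) = f t - hcob (fun u => f (x :: u)) t.
Proof. by []. Qed.

Lemma prism_cons a b f x t :
  prism a b f (x :: t) =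
  f (a x :: b x :: map b t) - prism a b (fun u => f (a x :: u)) t.
Proof. by []. Qed.

Lemma eq_hcob f g : f =1 g -> hcob f =1 hcob g.
Proof. by move=> /funext ->. Qed.

Lemma hcobD f g s : hcob (fun u => f u + g u) s = hcob f s + hcob g s.
Proof.
elim: s f g => [|x s IHs] f g; first by rewrite /= addr0.
by rewrite !hcob_cons IHs; ring.
Qed.

Lemma hcobB f g s : hcob (fun u => f u - g u) s = hcob f s - hcob g s.
Proof.
elim: s f g => [|x s IHs] f g; first by rewrite /= subr0.
by rewrite !hcob_cons IHs; ring.
Qed.

Lemma hcobZ k f s : hcob (fun u => k * f u) s = k * hcob f s.
Proof.
elim: s f => [|x s IHs] f; first by rewrite /= mulr0.
by rewrite !hcob_cons IHs; ring.
Qed.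

Lemma hcob_0 s : hcob (fun=> 0) s = 0.
Proof. by elim: s => //= x s ->; rewrite subr0. Qed.

Lemma hcob_map a f s : hcob f (map a s) = hcob (fun u => f (map a u)) s.
Proof. by elim: s f => //= x s IHs f; rewrite IHs. Qed.

Lemma hcob2 f s : hcob (hcob f) s = 0.
Proof.
elim: s f => //= x s IHs f.
by rewrite hcobB IHs subr0 subrr.
Qed.

Lemma prismB a b f g s :
  prism a b (fun u => f u - g u) s = prism a b f s - prism a b g s.
Proof.
elim: s f g => [|x s IHs] f g; first by rewrite /= subr0.
by rewrite !prism_cons IHs; ring.
Qed.

Lemma prismD a b f g s :
  prism a b (fun u => f u + g u) s = prism a b f s + prism a b g s.
Proof.
elim: s f g => [|x s IHs] f g; first by rewrite /= addr0.
by rewrite !prism_cons IHs; ring.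
Qed.

Lemma prism_map a b c f s :
  prism a b f (map c s) = prism (a \o c) (b \o c) f s.
Proof. by elim: s f => //= x s IHs f; rewrite IHs -map_comp. Qed.

Lemma prism_post a b c f s :
  prism (c \o a) (c \o b) f s = prism a b (fun u => f (map c u)) s.
Proof. by elim: s f => //= x s IHs f; rewrite IHs -!map_comp. Qed.

Lemma prism_0 a b s : prism a b (fun=> 0) s = 0.
Proof. by elim: s => //= x s ->; rewrite subr0. Qed.

(** The faces of the prism over a simplex cancel in pairs, except for its top
and its bottom. *)
Lemma prism_homotopy a b f s :
  hcob (prism a b f) s + prism a b (hcob f) s = f (map b s) - f (map a s).
Proof.
elim: s f => [|x s IHs] f; first by rewrite /= addr0 subrr.
rewrite hcob_cons.
rewrite (@eq_hcob _ (fun u => f (a x :: b x :: map b u)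
  - prism a b (fun u => f (a x :: u)) u)) // hcobB.
rewrite prism_cons.
rewrite (_ : (fun u => hcob f (a x :: u)) =
  (fun u => f u - hcob (fun u => f
    (a x :: u)) u)) // prismB 2!hcob_cons hcob_map.
have := IHs (fun u => f (a x :: u)); rewrite /=.
set p := hcob (prism _ _ _) _; set q := prism _ _ (hcob _) _ => E.
have -> : p = f (a x :: map b s) - f (a x :: map a s) - q by rewrite -E addrK.
ring.
Qed.

(** Under the map b^*, the retraction onto a subspace where f vanishes, a
cocycle becomes zero; the homotopy between the identity and b then gives a
primitive. *)
Lemma prism_primitive b f s : (forall u, hcob f u = 0) ->
  (forall u, f (map b u) = 0) -> hcob (fun u => - prism id b f u) s = f s.
Proof.
move=> /funext df fb; have := prism_homotopy id b f s.
rewrite map_id df prism_0 fb addr0 sub0r => E.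
rewrite (@eq_hcob _ (fun u => -1 * prism id b f u)) => [|u].
  by rewrite hcobZ E mulN1r opprK.
by rewrite mulN1r.
Qed.

Lemma prism_invar a b c f : (forall s, f (map c s) = f s) ->
  a \o c =1 c \o a -> b \o c =1 c \o b ->
  forall s, prism a b f (map c s) = prism a b f s.
Proof.
move=> fc /funext ac /funext bc s.
by rewrite prism_map ac bc prism_post; congr prism; apply/funext.
Qed.
End HomogeneousCochains.

(** * Actions of a right-angled Artin group *)

Section RaagActions.
Variable Gamma : sgraph.
Implicit Types (v w t : Gamma) (S T L : {set Gamma}).

Notation R :=
  [set r | exists v w : Gamma, adj v w /\ r = comm_word v w]%classic.
Notation G := (raag Gamma).
Implicit Types (g h : G).

Definition gen v : G := pres_pi R [:: (v, true)].

Lemma gen_inv v : ((gen v)^-1)%g = pres_pi R [:: (v, false)].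
Proof. exact: pres_inv_pi. Qed.

Lemma gen_comm v w : adj v w -> (gen v * gen w = gen w * gen v)%g.
Proof.
move=> vw; suff: ((gen v)^-1 * (gen w)^-1 * gen v * gen w = 1)%g.
  move=> E; rewrite -[RHS]mulg1 -[in RHS]E.
  by rewrite -!mulgA (mulVKg (gen v)) (mulVKg (gen w)).
rewrite !gen_inv.
rewrite [LHS](_ : _ = pres_mul (pres_mul (pres_mul (pres_pi R [:: (v, false)])
  (pres_pi R [:: (w, false)])) (gen v)) (gen w)) //.
rewrite /gen !pres_mul_pi; apply/pres_piP; apply: PresRel.
by exists v, w.
Qed.

(** The equivalence in the induction step takes care of the inverses of the
generators. *)
Lemma raag_ind (P : G -> Prop) :
  P 1%g -> (forall v g, P (gen v * g)%g <-> P g) -> forall g, P g.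
Proof.
move=> P1 PM g; rewrite -[g]pres_reprK.
elim: (repr g) => [//|[v b] s IHs].
have -> : pres_pi R ((v, b) :: s) = (pres_pi R [:: (v, b)] * pres_pi R s)%g.
  by rewrite [RHS]pres_mul_pi.
case: b; first exact/PM.
by rewrite -gen_inv; apply/(PM v); rewrite mulVKg.
Qed.

(** The universal property of the presentation, for actions on a type:
bijections of Y attached to the letters, commuting for adjacent vertices,
extend to G. All functions on G used below come from orbit maps of such
actions. *)
Section Action.
Variables (Y : Type) (a : Gamma -> bool -> Y -> Y).
Hypothesis aK : forall v b y, a v b (a v (~~ b) y) = y.
Hypothesis aC : forall v w y, adj v w ->
  a v true (a w true y) = a w true (a v true y).

Definition wact (s : word Gamma) (y : Y) : Y := foldr (fun l => a l.1 l.2) y s.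

Lemma wact_cat s s' y : wact (s ++ s') y = wact s (wact s' y).
Proof. by rewrite /wact foldr_cat. Qed.

Lemma wact_eq s s' y : pres_eq R s s' -> wact s y = wact s' y.
Proof.
move=> ss'; elim: ss' y => {s s'}.
- by [].
- by move=> s s' _ IH y; rewrite IH.
- by move=> s1 s2 s3 _ IH1 _ IH2 y; rewrite IH1.
- by move=> s s' t t' _ IHs _ IHt y; rewrite !wact_cat IHt IHs.
- by case=> v b y; rewrite /wact /= aK.
- move=> r [v [w [vw ->]]] y; rewrite /wact /=.
  have aKf u z : a u false (a u true z) = z by apply: (aK u false).
  by rewrite aC // aKf aKf.
Qed.

Definition gact g y := wact (repr g) y.

Lemma gact_pi s y : gact (pres_pi R s) y = wact s y.
Proof. by apply: wact_eq; apply: pres_repr. Qed.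

Lemma gact1 y : gact 1%g y = y.
Proof. exact: gact_pi. Qed.

Lemma gactM g h y : gact (g * h)%g y = gact g (gact h y).
Proof. by rewrite [LHS]gact_pi wact_cat. Qed.

Lemma gact_gen v y : gact (gen v) y = a v true y.
Proof. exact: gact_pi. Qed.
End Action.

Section Retraction.
Variable S : {set Gamma}.

Definition rho_act v (b : bool) y : G :=
  if v \in S then ((if b then gen v else (gen v)^-1) * y)%g else y.

Lemma rho_actK v b y : rho_act v b (rho_act v (~~ b) y) = y.
Proof.
by rewrite /rho_act; case: (v \in S) => //; case: b => /=;
  rewrite ?mulKg ?mulVKg.
Qed.

Lemma rho_actC v w y : adj v w ->
  rho_act v true (rho_act w true y) = rho_act w true (rho_act v true y).
Proof.
rewrite /rho_act => vw; case: ifP => //; case: ifP => // _ _.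
by rewrite !mulgA gen_comm.
Qed.

(** The retraction of G onto the subgroup generated by S that kills the other
vertices, as the orbit map of 1 under an action of G on itself. *)
Definition rho g : G := gact rho_act g 1%g.

Lemma rho1 : rho 1%g = 1%g.
Proof. exact: (gact1 rho_actK rho_actC). Qed.

Lemma rho_gen v g :
  rho (gen v * g)%g = if v \in S then (gen v * rho g)%g else rho g.
Proof.
by rewrite /rho (gactM rho_actK rho_actC) (gact_gen rho_actK rho_actC).
Qed.
End Retraction.

Lemma rho_rho S T g : T \subset S -> rho T (rho S g) = rho T g.
Proof.
move=> /fintype.subsetP TS; elim/raag_ind: g => [|v g]; first by rewrite !rho1.
rewrite [rho S _]rho_gen [rho T (_ * g)%g]rho_gen; case: ifP => vS.
  by rewrite rho_gen; case: ifP => // _; split=> [/mulgI|->].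
by case: ifP => // vT; rewrite TS in vS.
Qed.

Lemma rho_sub S T g : T \subset S -> rho S (rho T g) = rho T g.
Proof.
move=> /fintype.subsetP TS; elim/raag_ind: g => [|v g]; first by rewrite !rho1.
rewrite [rho T _]rho_gen; case: ifP => // vT.
by rewrite rho_gen TS //; split=> [/mulgI|->].
Qed.

Lemma rho0 g : rho finset.set0 g = 1%g.
Proof.
by elim/raag_ind: g => [|v g]; rewrite ?rho1 // rho_gen inE.
Qed.

Lemma rhoT g : rho finset.setT g = g.
Proof.
elim/raag_ind: g => [|v g]; rewrite ?rho1 // rho_gen inE.
by split=> [/mulgI|->].
Qed.

Section Character.
Variables (F : fieldType) (v : Gamma).

Definition chi_act w (b : bool) (k : F) : F :=
  (if b then (w == v)%:R else - (w == v)%:R) + k.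

Lemma chi_actK w b k : chi_act w b (chi_act w (~~ b) k) = k.
Proof. by rewrite /chi_act; case: b => /=; ring. Qed.

Lemma chi_actC w w' k : adj w w' ->
  chi_act w true (chi_act w' true k) = chi_act w' true (chi_act w true k).
Proof. by rewrite /chi_act => _; ring. Qed.

(** The exponent sum of v in g, as an element of F. *)
Definition chi g : F := gact chi_act g 0.

Lemma chi1 : chi 1%g = 0.
Proof. exact: (gact1 chi_actK chi_actC). Qed.

Lemma chi_gen w g : chi (gen w * g)%g = (w == v)%:R + chi g.
Proof.
by rewrite /chi (gactM chi_actK chi_actC) (gact_gen chi_actK chi_actC).
Qed.

Lemma chiM g h : chi (g * h)%g = chi g + chi h.
Proof.
elim/raag_ind: g => [|w g]; first by rewrite mul1g chi1 add0r.
by rewrite -mulgA !chi_gen -addrA; split=> [/addrI|->].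
Qed.

Lemma chiV g : chi (g^-1)%g = - chi g.
Proof. by apply/eqP; rewrite -addr_eq0 -chiM mulVg chi1. Qed.

Lemma chi_rho S g : chi (rho S g) = if v \in S then chi g else 0.
Proof.
elim/raag_ind: g => [|w g]; first by rewrite rho1 chi1; case: ifP.
rewrite rho_gen (fun_if chi) !chi_gen; case: (eqVneq w v) => [->|wv];
  last first.
  by rewrite !add0r; case: (w \in S).
by case: ifP => // _; split=> [/addrI|->].
Qed.
End Character.

(** For non-adjacent v and w, the group of triples (p, q, r) with the product
(p, q, r) (p', q', r') = (p + p', q + q', r + r' + p q') receives a
homomorphism from G: it sends a vertex z to (d, e, 0), where d is 1 if z = v
and 0 otherwise, and e is the same for w. Two such triples fail to commute
only if one comes from v and the other from w. The case v = w is allowed, and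
gives the vanishing of squares. *)
Section Heisenberg.
Variables (F : fieldType) (v w : Gamma).
Hypothesis vw : ~~ adj v w.

Definition heis_act z (b : bool) (y : F * F * F) : F * F * F :=
  let: (p, q, r) := y in
  let d := (z == v)%:R in let e := (z == w)%:R in
  if b then (d + p, e + q, r + d * q) else (p - d, q - e, r - d * (q - e)).

Lemma heis_actK z b y : heis_act z b (heis_act z (~~ b) y) = y.
Proof.
case: y => [[p q] r]; rewrite /heis_act; case: b => /=; congr (_, _, _); ring.
Qed.

Lemma heis_actC z z' y : adj z z' ->
  heis_act z true (heis_act z' true y) = heis_act z' true (heis_act z true y).
Proof.
case: y => [[p q] r] zz'; rewrite /heis_act.
have E : (z == v)%:R * (z' == w)%:R = (z' == v)%:R * (z == w)%:R :> F.
  rewrite -!natrM !mulnb; case: andP => [[/eqP zv /eqP z'w]|_].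
    by move: vw; rewrite -zv -z'w zz'.
  case: andP => // -[/eqP z'v /eqP zw].
  by move: vw; rewrite -zw -z'v adj_sym zz'.
rewrite !mulrDr E; congr (_, _, _); ring.
Qed.

Definition heis_mul (y y' : F * F * F) : F * F * F :=
  (y.1.1 + y'.1.1, y.1.2 + y'.1.2, y.2 + y'.2 + y.1.1 * y'.1.2).

Lemma heis_actM z y y' :
  heis_act z true (heis_mul y y') = heis_mul (heis_act z true y) y'.
Proof.
case: y y' => [[p q] r] [[p' q'] r']; rewrite /heis_act /heis_mul /=.
by congr (_, _, _); ring.
Qed.

Lemma heis_actI z : injective (heis_act z true).
Proof.
by apply: (can_inj (g := heis_act z false)) => y; apply: (heis_actK z false).
Qed.

Definition heis_coords g := gact heis_act g (0, 0, 0).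

Lemma heis_coords1 : heis_coords 1%g = (0, 0, 0).
Proof. exact: (gact1 heis_actK heis_actC). Qed.

Lemma heis_coords_gen z g :
  heis_coords (gen z * g)%g = heis_act z true (heis_coords g).
Proof.
by rewrite /heis_coords (gactM heis_actK heis_actC)
  (gact_gen heis_actK heis_actC).
Qed.

Lemma heis_coordsM g h :
  heis_coords (g * h)%g = heis_mul (heis_coords g) (heis_coords h).
Proof.
elim/raag_ind: g => [|z g].
  rewrite mul1g heis_coords1; case: (heis_coords h) => [[p q] r].
  by rewrite /heis_mul /= !add0r mul0r addr0.
by rewrite -mulgA !heis_coords_gen -heis_actM; split=> [/heis_actI|->].
Qed.

Lemma heis_coords_chi g : (heis_coords g).1 = (chi F v g, chi F w g).
Proof.
elim/raag_ind: g => [|z g]; first by rewrite heis_coords1 !chi1.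
rewrite heis_coords_gen !chi_gen; case: (heis_coords g) => [[p q] r] /=.
by split=> [[/addrI-> /addrI->]|[-> ->]].
Qed.

Definition heis g : F := (heis_coords g).2.

Lemma heisM g h : heis (g * h)%g = heis g + heis h + chi F v g * chi F w h.
Proof. by rewrite /heis heis_coordsM /= !heis_coords_chi. Qed.
End Heisenberg.

End RaagActions.

(** * Cocycles are generated by the characters *)

Section Spanning.
Variables (Gamma : sgraph) (F : fieldType).
Implicit Types (v w t : Gamma) (S T L : {set Gamma}).
Notation G := (raag Gamma).
Implicit Types (x g : G) (s : seq G) (phi psi : seq G -> F).

Definition translate v : G -> G := fun x => (gen v * x)%g.

Definition transl_invariant phi :=
  forall v s, phi (map (translate v) s) = phi s.

(** The cup product of the homomorphism chi_v with phi in homogeneous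
coordinates, where chi_v is the function (x, y) |-> chi_v y - chi_v x. *)
Definition hchi v phi s : F :=
  if s is x :: t then
    if t is y :: _ then (chi F v y - chi F v x) * phi t else 0
  else 0.

Definition hone s : F := (size s == 1%N)%:R.

Definition pull S phi s : F := phi (map (rho S) s).

(** If t commutes with the subgroup generated by L, this is the slant product
by t of the restriction of phi to that subgroup, pulled back to G: on
invariant phi the summands are the values of the inhomogeneous cochain with
t^-1 inserted in all possible positions. *)
Definition slant t L phi := prism (translate t \o rho L) (rho L) phi.

Lemma rho_translate S v x :
  rho S (translate v x) = if v \in S then translate v (rho S x) else rho S x.
Proof. exact: rho_gen. Qed.

Lemma pull_invariant S phi :
  transl_invariant phi -> transl_invariant (pull S phi).
Proof.
move=> iphi v s; rewrite /pull -map_comp.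
rewrite (eq_map (rho_translate S v)); case: (v \in S) => //.
by rewrite (map_comp (translate v)) iphi.
Qed.

Lemma invariant_translate phi g s : transl_invariant phi ->
  phi (map (fun x => g * x)%g s) = phi s.
Proof.
move=> iphi; elim/raag_ind: g => [|v g].
  by rewrite (eq_map (g := id)) ?map_id // => x; rewrite mul1g.
rewrite (eq_map (g := translate v \o (fun x => g * x)%g)) => [|x] /=.
  by rewrite map_comp iphi.
by rewrite /translate mulgA.
Qed.

Lemma hcob_pull S phi s : hcob (pull S phi) s = pull S (hcob phi) s.
Proof. by rewrite /pull hcob_map. Qed.

Lemma hchi_invariant v phi :
  transl_invariant phi -> transl_invariant (hchi v phi).
Proof.
move=> iphi w [|x [|y s]] //=.
congr (_ * _); last exact: (iphi w (y :: s)).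
by rewrite !chi_gen; ring.
Qed.

Lemma hcob_hchi v phi s : phi [::] = 0 ->
  hcob (hchi v phi) s = - hchi v (hcob phi) s.
Proof.
move=> phi0; case: s => [|x [|y s]] /=; rewrite ?subrr ?oppr0 //.
rewrite (hcobZ (chi F v y - chi F v x) (fun u => phi (y :: u))).
by case: s => [|z s]; set A := hcob _ _; rewrite ?phi0; ring.
Qed.

Lemma pull_hchi S v phi s :
  pull S (hchi v phi) s = if v \in S then hchi v (pull S phi) s else 0.
Proof.
case: s => [|x [|y s]]; rewrite /pull /= ?if_same // !chi_rho.
by case: ifP => //; rewrite subrr mul0r.
Qed.

Lemma slant_invariant t L phi : L \subset adj t -> transl_invariant phi ->
  transl_invariant (slant t L phi).
Proof.
move=> /fintype.subsetP Lt iphi v s; rewrite /slant;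
  case: (boolP (v \in L)) => vL.
  apply: prism_invar => [u|x|x] //=; rewrite rho_translate vL //.
  by rewrite /translate !mulgA (gen_comm (Lt _ vL)).
rewrite prism_map; congr prism; apply/funext => x /=;
  by rewrite rho_translate (negPf vL).
Qed.

(** The two ends of the prism differ by a translation by t, under which phi is
invariant. *)
Lemma slant_hcob t L phi s : transl_invariant phi ->
  slant t L (hcob phi) s = - hcob (slant t L phi) s.
Proof.
move=> iphi; apply/eqP; rewrite -addr_eq0 addrC prism_homotopy map_comp iphi.
by rewrite subrr.
Qed.

(** The retraction onto the subgroup generated by L is idempotent. *)
Lemma slant_pull t L phi s : pull L (slant t L phi) s = slant t L phi s.
Proof.
rewrite /pull /slant prism_map; congr prism; apply/funext => x /=;
  by rewrite rho_rho.
Qed.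

(** Only the first summand of the prism contributes, since chi_t is constant
on each of the two ends; it gives chi_t (t^-1) = -1. *)
Lemma slant_hchi t L phi s : t \notin L -> phi [::] = 0 ->
  slant t L (hchi t phi) s = - pull L phi s.
Proof.
move=> tL phi0; case: s => [|x s]; first by rewrite /pull /= phi0 oppr0.
have chi_slant y : chi F t (translate t (rho L y)) = 1.
  by rewrite /translate chi_gen eqxx chi_rho (negPf tL) addr0.
rewrite /slant prism_cons /= chi_slant chi_rho (negPf tL).
rewrite (_ : prism _ _ _ s = 0) => [|]; first by rewrite /pull /=; ring.
case: s => //= y s; rewrite !chi_slant subrr mul0r sub0r.
rewrite [X in prism _ _ X](_ : _ = fun=> 0) ?prism_0 ?oppr0 //.
by apply/funext => u; rewrite mul0r.
Qed.

(** The boundary map of the Bass-Serre tree of the HNN extension is onto: a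
function c invariant under the subgroup of L is the difference of e (t x) and
e x for some e invariant under the subgroup of T, up to composition with the
retraction onto the subgroup of S, the union of T and t. To define e without
normal forms, let G act on pairs of a tuple s and a scalar k, where the
vertices of T translate s, the vertex t also adds c s to k, and the remaining
vertices act trivially; the invariance of c is exactly what makes t commute
with the vertices of L. Then e (x_0, .., x_n) is the scalar of x_0 (s, 0),
where s is the tuple x_0^-1 (x_0, .., x_n). *)
Section Difference.
Variables (T : {set Gamma}) (t : Gamma) (c : seq G -> F).
Hypothesis cL : forall v s, v \in T -> adj t v -> c (map (translate v) s) = c s.
Hypothesis c0 : c [::] = 0.

Definition diff_act v (b : bool) (y : seq G * F) : seq G * F :=
  if v \in t |: T then
    if b then (map (translate v) y.1, y.2 + (if v == t then c y.1 else 0))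
    else let s := map (fun x => (gen v)^-1 * x)%g y.1 in
      (s, y.2 - (if v == t then c s else 0))
  else y.

Lemma diff_actK v b y : diff_act v b (diff_act v (~~ b) y) = y.
Proof.
rewrite /diff_act; case: (v \in _) => //; case: y => s k; case: b => /=.
  rewrite subrK; congr (_, _); rewrite -map_comp -[RHS]map_id.
  by apply: eq_map => x; rewrite /= /translate mulVKg.
rewrite -map_comp (eq_map (g := id)) => [|x]; first by rewrite map_id addrK.
by rewrite /= /translate mulKg.
Qed.

Lemma diff_actC v w y : adj v w ->
  diff_act v true (diff_act w true y) = diff_act w true (diff_act v true y).
Proof.
rewrite /diff_act => vw; case: ifP => // vS; case: ifP => // wS.
have E s : map (translate v) (map (translate w) s) =
           map (translate w) (map (translate v) s).
  rewrite -!map_comp; apply: eq_map => x.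
  by rewrite /= /translate !mulgA (gen_comm vw).
case: y => s k; congr (_, _) => /=; first exact: E.
rewrite -!addrA; congr (_ + _).
move: vS wS; rewrite !inE.
case: (eqVneq v t) => [vt|vt] /=; case: (eqVneq w t) => [wt|wt] //=.
- by rewrite vt wt adj_irr in vw.
- by move=> _ wT; rewrite cL ?add0r ?addr0 // -vt.
- by move=> vT _; rewrite cL ?add0r ?addr0 // -wt adj_sym.
Qed.

Definition based x s : seq G :=
  map (fun y => (rho (t |: T) x)^-1 * rho (t |: T) y)%g s.

Lemma based_translate v x s :
  based (translate v x) (map (translate v) s) = based x s.
Proof.
rewrite /based rho_translate -map_comp; apply: eq_map => y /=.
rewrite rho_translate; case: ifP => // vS.
by rewrite /translate invgM -mulgA mulKg.
Qed.

Definition primitive s : F :=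
  if s is x :: _ then (gact diff_act x (based x s, 0)).2 else 0.

Lemma diff_act_fst g s k :
  (gact diff_act g (s, k)).1 = map (fun x => rho (t |: T) g * x)%g s.
Proof.
elim/raag_ind: g => [|v g].
  rewrite (gact1 diff_actK diff_actC) rho1 /=.
  by rewrite (eq_map (g := id)) ?map_id // => x; rewrite mul1g.
rewrite (gactM diff_actK diff_actC) (gact_gen diff_actK diff_actC) rho_gen.
rewrite /diff_act; case: ifP => // vS.
case: (gact _ _ _) => s' k' /=.
have -> : map (fun x => gen v * rho (t |: T) g * x)%g s =
    map (translate v) (map (fun x => rho (t |: T) g * x)%g s).
  by rewrite -map_comp; apply: eq_map => x; rewrite /= /translate mulgA.
split=> [|-> //].
by apply: (inj_map (f := translate v)) => x x' /mulgI.
Qed.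

Lemma primitive_translate v s :
  primitive (map (translate v) s) =
  primitive s + (if v == t then c (map (rho (t |: T)) s) else 0).
Proof.
case: s => [|x s]; first by rewrite /= c0 if_same addr0.
rewrite [LHS](_ : _ = (gact diff_act (translate v x)
  (based (translate v x) (map (translate v) (x :: s)), 0)).2) //.
rewrite based_translate.
rewrite /primitive {1}/translate.
rewrite (gactM diff_actK diff_actC) (gact_gen diff_actK diff_actC).
have rhoE : map (fun y => rho (t |: T) x * y)%g (based x (x :: s)) =
    map (rho (t |: T)) (x :: s).
  by rewrite -map_comp; apply: eq_map => y /=; rewrite mulVKg.
have := diff_act_fst x (based x (x :: s)) 0; rewrite rhoE.
case: (gact _ _ _) => s' k; rewrite [X in X = _ -> _]/= => ->.
rewrite /diff_act; case: ifP => //= vS; last by case: eqP vS => [->|];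
  rewrite ?inE ?eqxx ?addr0.
Qed.
End Difference.

(** The injectivity in the Mayer-Vietoris sequence of the HNN extension. The
prism between the identity and the retraction onto T gives a primitive a of
phi that is invariant under T only. The defect b of its invariance under t is
an L-invariant cocycle, whose restriction to L is up to sign the slant product
of phi, that is 0; hence b is the coboundary of an L-invariant c. Writing c as
the defect of a T-invariant e makes a - d e invariant under T and t. *)
Lemma slant_kernel_exact T t L phi : t \notin T ->
  (forall v, v \in L = (v \in T) && adj t v) ->
  transl_invariant phi -> (forall s, hcob phi s = 0) ->
  (forall s, pull T phi s = 0) -> (forall s, slant t L phi s = 0) ->
  exists psi, [/\ transl_invariant psi, psi [::] = 0 &
    forall s, pull (t |: T) phi s = hcob psi s].
Proof.
move=> tT LE iphi dphi phiT phiL.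
have LT : L \subset T by apply/fintype.subsetP => v; rewrite LE => /andP[].
pose a s := - prism id (rho T) phi s.
have da s : hcob a s = phi s by apply: prism_primitive.
have aT v s : v \in T -> a (map (translate v) s) = a s.
  move=> vT; rewrite /a; congr (- _); apply: prism_invar => //.
  by move=> x /=; rewrite rho_translate vT.
pose b s := a (map (translate t) s) - a s.
have db s : hcob b s = 0.
  by rewrite hcobB -hcob_map !da iphi subrr.
(* On L, the first term of b is up to sign the slant product of phi, and the
   second one only involves values of phi on T. *)
have bL s : pull L b s = 0.
  rewrite /pull /b /a opprK -map_comp !prism_map.
  have := phiL s; rewrite /slant.
  have -> : rho T \o (translate t \o rho L) = rho L.
    by apply/funext => x /=; rewrite rho_translate (negPf tT) rho_sub.
  have -> : rho T \o rho L = rho L by apply/funext => x /=; rewrite rho_sub.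
  move=> ->; rewrite oppr0 add0r.
  rewrite (_ : rho L = rho T \o rho L); last first.
    by apply/funext => x /=; rewrite rho_sub.
  rewrite -[id \o _]/(rho T \o rho L) prism_post.
  rewrite (_ : (fun u => _) = fun=> 0) ?prism_0 //.
  by apply/funext => u; apply: phiT.
have bLi v s : v \in L -> b (map (translate v) s) = b s.
  rewrite LE => /andP[vT tv]; rewrite /b (aT v s) //; congr (_ - _).
  rewrite -[RHS](aT v) // -!map_comp; congr a; apply: eq_map => x /=.
  by rewrite /translate !mulgA (gen_comm tv).
(* The same construction as for a, now relative to L. *)
pose c s := - prism id (rho L) b s.
have dc s : hcob c s = b s by apply: prism_primitive.
have cL v s : v \in T -> adj t v -> c (map (translate v) s) = c s.
  move=> vT tv; have vL : v \in L by rewrite LE vT.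
  rewrite /c; congr (- _); apply: prism_invar => //; first by move=> u;
    apply: bLi.
  by move=> x /=; rewrite rho_translate vL.
have c0 : c [::] = 0 by rewrite /c /= oppr0.
pose e := primitive T t c.
have eE v s := primitive_translate cL c0 v s.
have iS : transl_invariant (fun s => pull (t |: T) a s - hcob e s).
  move=> v s; rewrite hcob_map /e (eq_hcob (eE v)) hcobD -/e.
  rewrite /pull -map_comp (eq_map (rho_translate (t |: T) v)) !inE.
  case: (eqVneq v t) => [->|vt] /=.
    have := dc (map (rho (t |: T)) s); rewrite hcob_map => ->.
    by rewrite /b (map_comp (translate t) (rho _)); ring.
  rewrite hcob_0 addr0; have [vT|//] := boolP (v \in T).
  by rewrite (map_comp (translate v) (rho _)) aT.
exists (fun s => pull (t |: T) a s - hcob e s); split=> // [|s].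
  by rewrite /pull /a /= oppr0 addr0.
by rewrite hcobB hcob2 subr0 hcob_pull /pull da.
Qed.

(** The cochains cohomologous to an element of the algebra generated by the
chi_v. *)
Inductive cup_generated : (seq G -> F) -> Prop :=
| CupCobound psi : transl_invariant psi -> psi [::] = 0 ->
    cup_generated (hcob psi)
| CupOne : cup_generated hone
| CupLin k phi psi : cup_generated phi -> cup_generated psi ->
    cup_generated (fun s => k * phi s + psi s)
| CupChi v phi : cup_generated phi -> cup_generated (hchi v phi).

Lemma cup_generatedB phi psi : cup_generated phi -> cup_generated psi ->
  cup_generated (fun s => phi s - psi s).
Proof.
move=> gphi gpsi; rewrite (_ : (fun s => _) = (fun s => -1 * psi s + phi s)).
  exact: CupLin.
by apply/funext => s; rewrite mulN1r addrC.
Qed.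

(** On constant tuples, prefixing 1 is a contraction onto the augmentation. *)
Lemma cocycle_trivial_group phi : (forall s, hcob phi s = 0) ->
  cup_generated (pull finset.set0 phi).
Proof.
move=> dphi; pose h s := phi (1%g :: map (fun=> 1%g) s) - phi [:: 1%g] *
  (nilp s)%:R.
have -> : pull finset.set0 phi = (fun s => phi [:: 1%g] * hone s + hcob h s).
  apply/funext => s; rewrite /h hcobB hcobZ.
  have := dphi (1%g :: map (rho finset.set0) s); rewrite hcob_cons.
  move=> /eqP; rewrite subr_eq0 => /eqP; rewrite /pull => ->.
  rewrite hcob_map (_ : hcob (fun u => (nilp u)%:R) s = hone s); last first.
    case: s => [//|x [|y s]]; first by rewrite /= subr0.
    by rewrite hcob_cons [hcob (fun=> _) _]hcob_0 subrr.
  rewrite addrC subrK; apply: eq_hcob => u; congr phi; congr (_ :: _).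
  by apply: eq_map => x; rewrite rho0.
apply: CupLin; first exact: CupOne.
apply: CupCobound; last by rewrite /h mulr1 subrr.
by move=> v s; rewrite /h -map_comp /nilp size_map.
Qed.

(** Induction on the number of vertices of S, for the pullbacks along the
retractions onto the subgroups generated by S. *)
Theorem cocycle_cup_generated phi : transl_invariant phi ->
  (forall s, hcob phi s = 0) -> phi [::] = 0 -> cup_generated phi.
Proof.
move=> + + phi0; suff main S psi : psi [::] = 0 -> transl_invariant psi ->
    (forall s, hcob psi s = 0) -> cup_generated (pull S psi).
  move=> iphi dphi; have := main finset.setT phi phi0 iphi dphi.
  congr cup_generated; apply/funext => s; rewrite /pull.
  by rewrite (eq_map (@rhoT _)) map_id.
move=> {phi phi0}; move: {2}(#|S|) (leqnn #|S|) => n.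
elim: n S psi => [|n IHn] S phi leSn phi0 iphi dphi.
  by move: leSn; rewrite leqn0 cards_eq0 => /eqP ->;
    apply: cocycle_trivial_group.
have [->|[t tS]] := set_0Vmem S; first exact: cocycle_trivial_group.
pose T := S :\ t; pose L := [set v in T | adj t v]%SET.
have tT : t \notin T by rewrite !inE eqxx.
have tL : t \notin L by rewrite !inE eqxx.
have ST : S = t |: T by rewrite finset.setD1K.
have leTn : (#|T| <= n)%N by rewrite (cardsD1 t) tS in leSn.
have LT : L \subset T by apply/fintype.subsetP => v; rewrite inE => /andP[].
have leLn : (#|L| <= n)%N by apply: leq_trans leTn; apply: subset_leq_card.
have Ladj : L \subset adj t by apply/fintype.subsetP => v;
  rewrite inE => /andP[].
have TS : T \subset S by rewrite ST subsetU1.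
(* phi1 vanishes on T, and phi2 has in addition a zero slant product with t. *)
pose phi1 s := phi s - pull T phi s.
have iphi1 : transl_invariant phi1.
  by move=> v s; rewrite /phi1 iphi pull_invariant.
have dphi1 s : hcob phi1 s = 0.
  by rewrite hcobB hcob_pull /pull !dphi subr0.
have phi1T s : pull T phi1 s = 0.
  rewrite /phi1 /pull -map_comp; apply/eqP; rewrite subr_eq0; apply/eqP.
  by congr phi; apply: eq_map => x /=; rewrite rho_rho.
pose j := slant t L phi1.
have ij : transl_invariant j by apply: slant_invariant.
have dj s : hcob j s = 0.
  apply/eqP; rewrite -oppr_eq0 -slant_hcob // /slant.
  by rewrite (_ : hcob phi1 = fun=> 0) ?prism_0 //; apply/funext.
pose phi2 s := phi1 s + hchi t j s.
have [|||||psi [ipsi psi0 psiE]] := @slant_kernel_exact T t L phi2 tT.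
- by move=> v; rewrite inE.
- by move=> v s; rewrite /phi2 iphi1 hchi_invariant.
- move=> s; rewrite hcobD dphi1 hcob_hchi // (_ : hcob j = fun=> 0);
  last exact/funext.
  by case: s => [|x [|y s]] /=; rewrite ?mulr0 oppr0 addr0.
- move=> s; have := pull_hchi T t j s; rewrite (negPf tT).
  by have := phi1T s; rewrite /pull /phi2 => -> ->; rewrite addr0.
- move=> s; rewrite /slant prismD -!/(slant _ _ _ _) slant_hchi //.
  by rewrite slant_pull subrr.
(* The first and the last term are generated by induction, since j is its own
   pullback from L. *)
have -> : pull S phi = (fun s => pull T phi s + hcob psi s - hchi t j s).
  apply/funext => s; rewrite -psiE -ST /pull /phi2 /phi1.
  have := pull_hchi S t j s; rewrite tS /pull => ->.
  rewrite -map_comp (eq_map (f := rho T \o rho S) (g := rho T)) => [|x] /=;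
    last first.
    by rewrite rho_rho.
  have -> : (fun s => j (map (rho S) s)) = j.
    apply/funext => u; rewrite -[LHS]slant_pull -[RHS]slant_pull /pull
      -map_comp.
    congr slant; apply: eq_map => x /=; rewrite rho_rho //.
    exact: fintype.subset_trans LT TS.
  ring.
apply: cup_generatedB.
  rewrite (_ : (fun s => _) = (fun s => 1 * pull T phi s + hcob psi s)).
    by apply: CupLin; [apply: IHn | apply: CupCobound].
  by apply/funext => s; rewrite mul1r.
apply: CupChi; rewrite (_ : j = pull L j); last by apply/funext => s;
  rewrite slant_pull.
exact: IHn.
Qed.

End Spanning.

(** * Linear independence of the clique monomials *)

Definition clique (Gamma : sgraph) (C : {set Gamma}) : bool :=
  [forall v in C, forall w in C, (v != w) ==> adj v w].

Lemma cliqueP (Gamma : sgraph) (C : {set Gamma}) :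
  reflect {in C &, forall v w, v != w -> adj v w} (clique C).
Proof.
apply: (iffP 'forall_in_forall_inP) => H v w vC wC; last by apply/implyP;
  exact: H.
by move/implyP: (H v vC w wC).
Qed.

Lemma clique_pairwise (Gamma : sgraph) (C : {set Gamma}) :
  clique C -> pairwise (@adj Gamma) (enum C).
Proof.
move=> /cliqueP cC; have := enum_uniq C; have: {subset enum C <= C}.
  by move=> v; rewrite mem_enum.
elim: (enum C) => //= v s IHs sC /andP[vs us]; rewrite IHs //; last first.
  by move=> w ws; apply: sC; rewrite inE ws orbT.
rewrite andbT; apply/allP => w ws; apply: cC.
- by apply: sC; rewrite inE eqxx.
- by apply: sC; rewrite inE ws orbT.
- by apply: contraNneq vs => ->.
Qed.

Section Independence.
Variables (Gamma : sgraph) (F : fieldType).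
Notation G := (raag Gamma).
Implicit Types (s : seq G) (phi psi : seq G -> F) (w : seq Gamma).
Implicit Types (C S : {set Gamma}).

Definition hword w : seq G -> F := foldr (@hchi Gamma F) (@hone Gamma F) w.

Lemma hword_nil w : hword w [::] = 0.
Proof. by case: w. Qed.

Lemma pull_hword S w s :
  pull S (hword w) s = if all (mem S) w then hword w s else 0.
Proof.
elim: w s => [|v w IHw] s; first by rewrite /pull /= /hone size_map.
rewrite /= pull_hchi; case: (v \in S) => //=.
have -> : pull S (foldr (hchi (F:=F)) (@hone Gamma F) w) =
    (fun s => if all (mem S) w then hword w s else 0) by apply/funext.
by case: (all _ w) => //; case: s => [|x [|y s]] //=; rewrite mulr0.
Qed.

(** The slant product with the first letter t strips it from the word and maps
primitives to primitives. The empty word is not exact because the coboundary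
of a cochain that vanishes on the empty tuple vanishes on 1-tuples. *)
Lemma hword_nonexact w : pairwise (@adj Gamma) w ->
  forall psi, transl_invariant psi -> psi [::] = 0 ->
  ~ (forall s, hword w s = hcob psi s).
Proof.
elim: w => [|t w IHw] /= => [_|/andP[/allP tw wP]] psi ipsi psi0 E.
  have := E [:: 1%g]; rewrite /hone /= psi0 subr0 => /eqP.
  by rewrite oner_eq0.
pose L := [set v in w]%SET.
have Lt : L \subset adj t by apply/fintype.subsetP => v; rewrite inE => /tw.
have tL : t \notin L by rewrite inE; apply: contraFN (adj_irr t) => /tw.
apply: (IHw wP (slant t L psi)) => // [|s]; first exact: slant_invariant.
have <- : pull L (hword w) s = hword w s.
  by rewrite pull_hword; case: allP => // -[] v vw; rewrite /= inE.
rewrite -[LHS]opprK -(slant_hchi _ tL) ?hword_nil // -[RHS]opprK -slant_hcob //.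
by congr (- slant _ _ _ _); apply/funext.
Qed.

(** Take a clique C1 of minimal size with a nonzero coefficient. The
retraction onto C1 kills the monomials of the cliques that C1 does not
contain, and the proper subcliques of C1 have coefficient zero. *)
Lemma hword_clique_free (c : {set Gamma} -> F) psi :
  transl_invariant psi -> psi [::] = 0 ->
  (forall s, \sum_(C | clique C) c C * hword (enum C) s = hcob psi s) ->
  forall C, clique C -> c C = 0.
Proof.
move=> ipsi psi0 E C0 cC0; apply/eqP; apply: contraT => c0.
have Ex : clique C0 && (c C0 != 0) by rewrite cC0.
have [C1 /andP[cC1 c1] minC] :=
  @arg_minnP _ C0 (fun C => clique C && (c C != 0)) (fun C => #|C|) Ex.
exfalso; apply: (@hword_nonexact (enum C1) (clique_pairwise cC1)
  (fun s => (c C1)^-1 * pull C1 psi s)).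
- by move=> v s; rewrite pull_invariant.
- by rewrite /pull psi0 mulr0.
move=> s; rewrite hcobZ hcob_pull /pull -E (bigD1 C1) //= big1 =>
  [|C /andP[cC CC1]].
  have := pull_hword C1 (enum C1) s; rewrite /pull => ->.
  rewrite (_ : all _ _) ?addr0 ?mulKf //.
  by apply/allP => v; rewrite mem_enum.
have := pull_hword C1 (enum C) s; rewrite /pull => ->.
case: allP => [CC|_]; last by rewrite mulr0.
have [->|cn0] := eqVneq (c C) 0; first by rewrite mul0r.
have sub : C \subset C1 by apply/fintype.subsetP => v vC; apply: CC;
  rewrite mem_enum.
have := minC C; rewrite cC cn0 => /(_ isT) leC.
by case/eqP: CC1; apply/eqP; rewrite eqEcard sub.
Qed.
End Independence.

(** * The cohomology algebra *)

Section DegreeOne.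
Variables (X : Type) (F : fieldType).
Implicit Types (h : X -> F) (f : seq X -> F) (s : seq X).

Definition fun1 h s : F := if s is [:: x] then h x else 0.

Lemma bounded_fun1 h : bounded_deg (fun1 h).
Proof. by apply/asboolP; exists 2 => -[|x [|y s]]. Qed.

Lemma seq_mul_fun1 h f s :
  seq_mul (fun1 h) f s = if s is x :: t then h x * f t else 0.
Proof.
case: s => [|x s]; first by rewrite seq_mul_nil mul0r.
rewrite seq_mul_cons mul0r add0r -[in RHS](seq_mul1 f s) -seq_mulZl.
by apply: eq_seq_mul => // -[|y t] //=; rewrite /seq_one ?mulr1 ?mulr0.
Qed.
End DegreeOne.

Section Homogenization.
Variables (G : groupType) (F : fieldType).
Implicit Types (f g : seq G -> F) (s : seq G).

Definition ratio (x y : G) : G := (x^-1 * y)%g.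

(** The passage to homogeneous coordinates: the inhomogeneous cochain f
becomes (x_0, .., x_n) |-> f (x_0^-1 x_1, .., x_(n-1)^-1 x_n), extended by 0
to the empty sequence. *)
Definition homogenize f s : F :=
  if s is x :: t then f (pairmap ratio x t) else 0.

Lemma cob_tail_homogenize f x y s :
  hcob (fun u => f (pairmap ratio x u)) (y :: s) =
  cob_tail f (ratio x y) (pairmap ratio y s).
Proof.
elim: s f x y => [|z s IHs] f x y; first by rewrite /= cob_tail_nil subr0.
rewrite hcob_cons (IHs (fun u => f (ratio x y :: u)) y z) [pairmap _ _
  (z :: s)]/=.
rewrite cob_tail_cons; congr (f (_ :: _) - _).
by rewrite /ratio -mulgA mulVKg.
Qed.

Lemma hcob_homogenize f : hcob (homogenize f) = homogenize (cobound_fun f).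
Proof.
apply/funext => -[//|x [|y s]]; first by rewrite /= subr0.
rewrite hcob_cons cob_tail_homogenize [in RHS]/homogenize.
by rewrite [pairmap _ _ _]/= cobound_cons.
Qed.

Lemma ratioK s : pairmap ratio 1%g (scanl *%g 1%g s) = s.
Proof. by apply: scanlK => x y; rewrite /ratio mulKg. Qed.

Lemma homogenize_inj f g : homogenize f = homogenize g -> f = g.
Proof.
move=> E; apply/funext => s.
have := congr1 (fun h => h (1%g :: scanl *%g 1%g s)) E.
by rewrite /= ratioK.
Qed.

Lemma cobound_fun1 (h : G -> F) s :
  cobound_fun (fun1 h) s =
  if s is [:: x; y] then h y - (h (x * y)%g - h x) else 0.
Proof.
case: s => [//|x [|y [|z s]]]; rewrite ?cobound_cons.
- by rewrite cob_tail_nil subrr.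
- by rewrite cob_tail_cons cob_tail_nil.
rewrite -cobound_cons -[RHS](cobound0_fun F [:: x, y, z & s]).
by apply: (@cobound_local _ _ _ _ (size s).+2) => // -[|? [|? ?]].
Qed.
End Homogenization.
Arguments ratio {G}.

Section RaagCohomology.
Variables (Gamma : sgraph) (F : fieldType).
Notation G := (raag Gamma).
Notation H := (cohomology G F).
Implicit Types (v w : Gamma) (s : seq G).

Lemma homogenize_invariant (f : seq G -> F) : transl_invariant (homogenize f).
Proof.
move=> v [|x s] //=; congr f; elim: s x => //= y s IHs x.
by rewrite IHs /ratio /translate invgM -mulgA mulKg.
Qed.

Lemma invariant_homogenize (psi : seq G -> F) :
  transl_invariant psi -> psi [::] = 0 ->
  psi = homogenize (fun s => psi (1%g :: scanl *%g 1%g s)).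
Proof.
move=> ipsi psi0; apply/funext => -[//|x s] /=.
rewrite -[RHS](invariant_translate x _ ipsi) /= mulg1; congr (psi (_ :: _)).
rewrite -[LHS](pairmapK (g := *%g) (f := ratio) _ x); last first.
  by move=> y z; rewrite /ratio mulVKg.
move: (pairmap ratio x s) => u; rewrite -[in LHS](mulg1 x).
elim: u 1%g => //= y u IHu z; by rewrite -mulgA IHu.
Qed.

Lemma homogenize_chi v f :
  homogenize (seq_mul (fun1 (chi F v)) f) = hchi v (homogenize f).
Proof.
apply/funext => -[//|x [|y s]]; rewrite /homogenize seq_mul_fun1 //=.
by rewrite chiM chiV addrC.
Qed.

Lemma homogenize_one : homogenize (@seq_one G F) = @hone Gamma F.
Proof. by apply/funext => -[//|x [|y s]]. Qed.

Lemma chi_is_cocycle v : is_cocycle (SeqAlg (bounded_fun1 (chi F v))).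
Proof.
apply/eqP/seqalgP => s; rewrite -[LHS]/(cobound_fun (fun1 (chi F v)) s).
rewrite cobound_fun1.
case: s => [//|x [//|y [|//]]]; rewrite chiM -[RHS]/(0 : F); ring.
Qed.

Definition chi_cocycle v : cocycle G F := Cocycle (chi_is_cocycle v).

Definition chi_class v : H := quot_pi (cobound_ideal G F) (chi_cocycle v).

Lemma chi_class_degree v : grpart H 1 (chi_class v).
Proof. by exists (chi_cocycle v) => // -[|x [|y s]]. Qed.

(** The central Heisenberg coordinate is, up to sign, a primitive. *)
Lemma chi_class_nonadj v w : ~~ adj v w -> chi_class v * chi_class w = 0.
Proof.
move=> vw; rewrite -rmorphM -(linear0 (quot_pi _)); apply/quot_piP.
exists (SeqAlg (bounded_fun1 (fun x => - heis F v w x))).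
rewrite subr0; apply: seqalgP => s.
rewrite -[LHS]/(seq_mul (fun1 (chi F v)) (fun1 (chi F w)) s) seq_mul_fun1.
rewrite -[RHS]/(cobound_fun (fun1 _) s) cobound_fun1.
case: s => [//|x [|y [|z s]]] /=; rewrite ?mulr0 // (heisM _ vw); ring.
Qed.

(** The pointwise product of the characters is, up to sign, a primitive. *)
Lemma chi_class_anticomm v w :
  chi_class v * chi_class w = - (chi_class w * chi_class v).
Proof.
apply/eqP; rewrite -addr_eq0 -!rmorphM -rmorphD; apply/eqP.
rewrite -(linear0 (quot_pi _)); apply/quot_piP.
exists (SeqAlg (bounded_fun1 (fun x => - (chi F v x * chi F w x)))).
rewrite subr0; apply: seqalgP => s.
rewrite -[LHS]/(seq_mul (fun1 (chi F v)) (fun1 (chi F w)) s +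
  seq_mul (fun1 (chi F w)) (fun1 (chi F v)) s).
rewrite !seq_mul_fun1 -[RHS]/(cobound_fun (fun1 _) s) cobound_fun1.
case: s => [|x [|y [|z s]]] /=; rewrite ?mulr0 ?addr0 // !chiM; ring.
Qed.

Lemma seqalg_sumE (I : Type) (r : seq I) (P : pred I) (a : I -> seqalg G F) s :
  (\sum_(i <- r | P i) a i) s = \sum_(i <- r | P i) a i s.
Proof. exact: (big_morph (fun b : seqalg G F => b s)). Qed.

Lemma homogenize_chi_prod (w : seq Gamma) :
  homogenize (val (\prod_(v <- w) chi_cocycle v)) = hword F w.
Proof.
elim: w => [|v w IHw]; first by rewrite big_nil rmorph1 /= homogenize_one.
by rewrite big_cons rmorphM /= -IHw -homogenize_chi.
Qed.

Lemma chi_class_clique_free (c : {set Gamma} -> F) :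
  \sum_(C | clique C) c C *: \prod_(v <- enum C) chi_class v = 0 ->
  forall C, clique C -> c C = 0.
Proof.
move=> c0.
pose z := \sum_(C | clique C) c C *: \prod_(v <- enum C) chi_cocycle v.
have : quot_pi (cobound_ideal G F) z = quot_pi _ 0.
  rewrite [RHS]linear0 -c0 [LHS]linear_sum; apply: eq_bigr => C _.
  by rewrite [LHS]linearZ; congr (_ *: _); rewrite rmorph_prod.
move=> /quot_piP; rewrite subr0 => -[f zf].
apply: (@hword_clique_free _ _ c (homogenize f)) => //.
  exact: homogenize_invariant.
move=> s; rewrite hcob_homogenize -[cobound_fun f]/(seqfun (cobound f)) -zf.
under eq_bigr => C _ do rewrite -homogenize_chi_prod.
case: s => [|x s] /=; first by rewrite big1 // => C _; rewrite mulr0.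
have -> : cocycle_val z =
    \sum_(C | clique C) c C *: val (\prod_(v <- enum C) chi_cocycle v).
  by rewrite -[LHS]/(val z) linear_sum; apply: eq_bigr => C _; rewrite linearZ.
by rewrite seqalg_sumE.
Qed.

Definition trunc N (phi : seq G -> F) s : F :=
  if (size s <= N)%N then phi s else 0.

Section Span.
Variable P : H -> Prop.
Hypotheses (P1 : P 1) (Plin : forall k a b, P a -> P b -> P (k *: a + b)).
Hypothesis PM : forall v a, P a -> P (chi_class v * a).

(** The cochains of cup_generated are arbitrary functions on sequences,
whereas the elements of the cohomology algebra have bounded degree, whence the
truncations. *)
Lemma cup_generated_class phi : cup_generated phi -> forall N,
  exists z : cocycle G F, trunc N phi = homogenize (val z) /\
    P (quot_pi (cobound_ideal G F) z).
Proof.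
have P0 : P 0 by rewrite -(subrr 1) addrC -scaleN1r; apply: Plin.
elim=> {phi}.
- move=> psi ipsi psi0 N; rewrite (invariant_homogenize ipsi psi0).
  set f := (fun s => psi _); rewrite hcob_homogenize.
  (* Homogenizing and taking the coboundary each add one entry. *)
  have bf : bounded_deg (fun s => if ((size s).+1 < N)%N then f s else 0).
    by apply/asboolP; exists N => s sN; rewrite ltnNge (leq_trans sN).
  have dz : is_cocycle (cobound (SeqAlg bf)) by apply/eqP; apply: cobound2.
  exists (Cocycle dz); split.
    apply/funext => -[//|x s].
    rewrite /trunc /=; set u := pairmap _ _ _.
    have -> : size s = size u by rewrite size_pairmap.
    case: u => [|y u]; first by rewrite if_same.
    rewrite -/(cobound_fun _ _) -/(cobound_fun _ (y :: u)); case: ifP => uN.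
      by apply: (@cobound_local _ _ _ _ (size u)) => // t ->; rewrite ifT.
    rewrite -[LHS](cobound0_fun F (y :: u)).
    by apply: (@cobound_local _ _ _ _ (size u)) => // t ->; rewrite ifF.
  rewrite [X in P X](_ : _ = 0) // -(linear0 (quot_pi _)); apply/quot_piP.
  by rewrite subr0; exists (SeqAlg bf).
- case=> [|N].
    exists 0; split; last by rewrite linear0.
    by apply/funext => -[|x s].
  exists 1; split; last by rewrite rmorph1.
  by rewrite rmorph1 homogenize_one; apply/funext => -[|x [|y s]] //;
    rewrite /trunc if_same.
- move=> k phi psi _ IHphi _ IHpsi N.
  have [z [zE Pz]] := IHphi N; have [z' [zE' Pz']] := IHpsi N.
  exists (k *: z + z'); split; last by rewrite linearP; apply: Plin.
  rewrite linearP; apply/funext => s.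
  rewrite [RHS](_ : _ = k * homogenize (val z) s + homogenize (val z') s).
    by rewrite -zE -zE' /trunc; case: ifP => // _; rewrite mulr0 addr0.
  by case: s => //=; rewrite mulr0 addr0.
- move=> v phi _ IHphi N; have [z [zE Pz]] := IHphi N.-1.
  exists (chi_cocycle v * z); split; last by rewrite rmorphM; apply: PM.
  rewrite rmorphM [RHS](_ : _ = homogenize (seq_mul (fun1 (chi F v))
    (val z))) //.
  rewrite homogenize_chi -zE; apply/funext => -[|x [|y s]] //=.
    by rewrite /trunc if_same.
  by rewrite /trunc [RHS](fun_if ( *%R _)) mulr0; case: N {zE}.
Qed.

Lemma chi_class_span a : P a.
Proof.
have [z0 ->] := quot_piS a; case fE : (val z0) => [f bf];
  move/asboolP: (bf) => [N fN].
have : cup_generated (homogenize (val z0)).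
  apply: cocycle_cup_generated => // [|s]; first exact: homogenize_invariant.
  rewrite hcob_homogenize -[cobound_fun _]/(seqfun (cobound (val z0))).
  by rewrite (eqP (valP z0 : is_cocycle (val z0))); case: s.
move=> /cup_generated_class /(_ N) [z [zE Pz]].
suff -> : z0 = z by [].
apply: val_inj; apply: seqalgP => s; apply: (congr1 (@^~ s)).
apply: homogenize_inj; rewrite -zE; apply/funext => -[//|x t].
rewrite /trunc; case: ifP => //= /negbT; rewrite -leqNgt => Nt.
by rewrite fE /= fN // size_pairmap.
Qed.
End Span.
End RaagCohomology.

(** * Exterior face algebras and their colon ideals *)

Lemma clique_setU1 (Gamma : sgraph) v (C : {set Gamma}) :
  clique C -> (forall w, w \in C -> adj v w) -> clique (v |: C).
Proof.
move=> /cliqueP cC vC; apply/cliqueP => x y /setU1P[->|xC] /setU1P[->|yC].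
- by rewrite eqxx.
- by move=> _; apply: vC.
- by move=> _; rewrite adj_sym; apply: vC.
- exact: cC.
Qed.

Lemma clique1 (Gamma : sgraph) (v : Gamma) : clique [set v].
Proof. by apply/cliqueP => x y /set1P -> /set1P ->; rewrite eqxx. Qed.

Section ExteriorFaceRing.
Variables (Gamma : sgraph) (F : fieldType) (A : algType F) (u : Gamma -> A).
Hypothesis u_nonadj : forall v w, ~~ adj v w -> u v * u w = 0.
Hypothesis u_anti : forall v w, u v * u w = - (u w * u v).
Implicit Types (v w r : Gamma) (s : seq Gamma) (C D E Y : {set Gamma}).
Implicit Types (a b : A).

Definition mono s : A := \prod_(v <- s) u v.
Definition face C : A := mono (enum C).

Lemma mono_cons v s : mono (v :: s) = u v * mono s.
Proof. exact: big_cons. Qed.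

Lemma mono_cat s s' : mono (s ++ s') = mono s * mono s'.
Proof. exact: big_cat. Qed.

Lemma gen_mono v s : u v * mono s = (-1) ^+ size s *: (mono s * u v).
Proof.
elim: s => [|w s IHs]; first by rewrite /mono big_nil mulr1 mul1r scale1r.
rewrite mono_cons mulrA u_anti mulNr -!mulrA IHs -scalerAr exprS.
by rewrite mulN1r scaleNr.
Qed.

Lemma mono_comm s s' :
  mono s * mono s' = (-1) ^+ (size s * size s') *: (mono s' * mono s).
Proof.
elim: s => [|v s IHs]; first by rewrite /mono big_nil mulr1 mul1r scale1r.
rewrite mono_cons -mulrA IHs -scalerAr !mulrA gen_mono -!scalerAl scalerA.
by rewrite -exprD mulSn addnC.
Qed.

Lemma mono_perm s s' : perm_eq s s' -> exists n, mono s = (-1) ^+ n *: mono s'.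
Proof.
move=> ss'; have : exists n, mono s = (-1) ^+ n *: mono s by exists 0;
  rewrite scale1r.
apply: (catCA_perm_ind (P := fun t =>
  exists n, mono s = (-1) ^+ n *: mono t)) ss'.
move=> s1 s2 s3 [n ->]; exists (n + size s1 * size s2)%N.
by rewrite !mono_cat !mulrA mono_comm -scalerAl scalerA -exprD.
Qed.

Lemma gen_mono0 v w s : w \in s -> ~~ adj v w -> u v * mono s = 0.
Proof.
move=> /splitPr[s1 s2] vw.
by rewrite mono_cat mono_cons mulrA gen_mono -scalerAl mulrA -(mulrA _
  (u v)) u_nonadj // mulr0 mul0r scaler0.
Qed.

Lemma face0 : face finset.set0 = 1.
Proof. by rewrite /face enum_set0 /mono big_nil. Qed.

Lemma face1 v : face [set v] = u v.
Proof. by rewrite /face enum_set1 /mono big_seq1. Qed.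

Lemma gen_face0 v w C : w \in C -> ~~ adj v w -> u v * face C = 0.
Proof. by move=> wC; apply: gen_mono0; rewrite mem_enum. Qed.

Lemma gen_face v C : v \notin C ->
  exists n, u v * face C = (-1) ^+ n *: face (v |: C).
Proof.
move=> vC; rewrite -mono_cons; apply: mono_perm; apply: uniq_perm.
- by rewrite /= mem_enum vC enum_uniq.
- exact: enum_uniq.
- by move=> w; rewrite inE !mem_enum !inE.
Qed.

Lemma face_gen v C : exists n, face C * u v = (-1) ^+ n *: (u v * face C).
Proof.
exists (size (enum C)); rewrite gen_mono scalerA -exprD addnn -mul2n exprM.
by rewrite sqrrN expr1n expr1n scale1r.
Qed.

(** The product of a generator with a face vanishes as soon as the face
contains a vertex that is not adjacent to the generator, in particular the
generator itself. *)
Variant gen_face_spec v C : A -> Prop :=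
| GenFaceZero w of w \in C & ~~ adj v w : gen_face_spec v C 0
| GenFaceAdd n of v \notin C & clique (v |: C) &
    (forall w, w \in C -> adj v w) :
    gen_face_spec v C ((-1) ^+ n *: face (v |: C)).

Lemma gen_faceP v C : clique C -> gen_face_spec v C (u v * face C).
Proof.
move=> cC; have [/forall_inP vC|/forall_inPn[w wC vw]] :=
    boolP [forall w in C, adj v w]; last first.
  by rewrite (gen_face0 wC vw); apply: GenFaceZero vw.
have nC : v \notin C by apply: contraFN (adj_irr v) => /vC.
have [n ->] := gen_face nC; apply: GenFaceAdd => //.
exact: clique_setU1.
Qed.

Definition face_span (Q : pred {set Gamma}) a : Prop :=
  exists c : {set Gamma} -> F, a = \sum_(C | clique C && Q C) c C *: face C.

Section FaceSpan.
Variable Q : pred {set Gamma}.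

Lemma face_span_lin k a b :
  face_span Q a -> face_span Q b -> face_span Q (k *: a + b).
Proof.
move=> [c ->] [d ->]; exists (fun C => k * c C + d C).
rewrite scaler_sumr -big_split; apply: eq_bigr => C _ /=.
by rewrite scalerDl scalerA.
Qed.

Lemma face_span0 : face_span Q 0.
Proof. by exists (fun=> 0); rewrite big1 // => C _; rewrite scale0r. Qed.

Lemma face_spanZ k a : face_span Q a -> face_span Q (k *: a).
Proof.
by move=> Qa; rewrite -[_ *: _]addr0; apply: face_span_lin => //;
  apply: face_span0.
Qed.

Lemma face_span_face C : clique C -> Q C -> face_span Q (face C).
Proof.
move=> cC QC; exists (fun D => (D == C)%:R).
rewrite (bigD1 C) ?cC //= eqxx scale1r big1 ?addr0 // => D /andP[_ /negPf->].
by rewrite scale0r.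
Qed.

Lemma face_span_ind (P : A -> Prop) : P 0 ->
  (forall k a b, P a -> P b -> P (k *: a + b)) ->
  (forall C, clique C -> Q C -> P (face C)) -> forall a, face_span Q a -> P a.
Proof.
move=> P0 Plin PC a [c ->]; elim/big_rec: _ => // C b /andP[cC QC] Pb.
by apply: Plin => //; apply: PC.
Qed.

Hypothesis Qup : forall v C, Q C -> Q (v |: C).

Lemma face_span_gen v a : face_span Q a -> face_span Q (u v * a).
Proof.
move: a; apply: face_span_ind => [|k a b IHa IHb|C cC QC].
- by rewrite mulr0; apply: face_span0.
- by rewrite mulrDr -scalerAr; apply: face_span_lin.
case: (gen_faceP v cC) => [w _ _|n _ cvC _]; first exact: face_span0.
by apply: face_spanZ; apply: face_span_face => //; apply: Qup.
Qed.

Lemma face_span_genr v a : face_span Q a -> face_span Q (a * u v).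
Proof.
move: a; apply: face_span_ind => [|k a b IHa IHb|C cC QC].
- by rewrite mul0r; apply: face_span0.
- by rewrite mulrDl -scalerAl; apply: face_span_lin.
have [n ->] := face_gen v C; apply/face_spanZ/face_span_gen.
exact: face_span_face.
Qed.
End FaceSpan.

(* The u v generate the algebra, in the form of an induction principle. *)
Hypothesis u_span : forall P : A -> Prop, P 1 ->
  (forall k a b, P a -> P b -> P (k *: a + b)) ->
  (forall v a, P a -> P (u v * a)) -> forall a, P a.

Lemma face_span_all a : face_span predT a.
Proof.
move: a; apply: u_span => [|k a b|v a]; last exact: face_span_gen.
  by rewrite -face0; apply: face_span_face => //; apply/cliqueP => v;
    rewrite inE.
exact: face_span_lin.
Qed.

Lemma face_span_ideal (Q : pred {set Gamma}) :
  (forall v C, Q C -> Q (v |: C)) -> is_ideal (face_span Q).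
Proof.
move=> Qup; split=> [|a b Qa Qb|a|a b]; first exact: face_span0.
- by rewrite -[a]scale1r; apply: face_span_lin.
- move: a; apply: u_span => [b|k x y IHx IHy b Qb|v x IHx b Qb].
  + by rewrite mul1r.
  + by rewrite mulrDl -scalerAl; apply: face_span_lin; [apply: IHx|apply: IHy].
  + by rewrite -mulrA; apply: face_span_gen => //; apply: IHx.
- move: b a; apply: u_span => [a|k x y IHx IHy a Qa|v x IHx a Qa].
  + by rewrite mulr1.
  + by rewrite mulrDr -scalerAr; apply: face_span_lin; [apply: IHx|apply: IHy].
  + by rewrite mulrA; apply: IHx; apply: face_span_genr.
Qed.

Definition gens Y : set A := (u @` [set v | v \in Y])%classic.

(** Multiplication by a generator sends a face to zero or to a larger face, so
that the faces meeting Y span an ideal. *)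
Lemma gens_face_span Y a : ideal_gen (gens Y) a ->
  face_span (fun C => ~~ [disjoint C & Y]) a.
Proof.
apply; first apply: face_span_ideal => v C.
  by apply: contra; apply: disjointWl; apply: finset.subsetUr.
move=> _ [v vY <-]; rewrite -face1; apply: face_span_face; first exact: clique1.
by apply/pred0Pn; exists v; rewrite /= inE eqxx.
Qed.

Lemma ideal_genZ (I : set A) k a : is_ideal I -> I a -> I (k *: a).
Proof. by case=> _ _ IM _ Ia; rewrite -mulr_algl; apply: IM. Qed.

Lemma face_ideal Y C : ~~ [disjoint C & Y] -> ideal_gen (gens Y) (face C).
Proof.
move=> /pred0Pn[v /andP[/= vC vY]] I idI YI.
rewrite /face; have : v \in enum C by rewrite mem_enum.
case/splitPr => s1 s2; rewrite mono_cat mono_cons.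
case: (idI) => _ _ Il Ir; apply/Il/Ir/YI.
by exists v.
Qed.

Hypothesis u_free : forall c : {set Gamma} -> F,
  \sum_(C | clique C) c C *: face C = 0 -> forall C, clique C -> c C = 0.

(** The coefficients in the basis of faces are unique, hence linear. *)
Lemma face_coord : exists k : A -> {set Gamma} -> F,
  [/\ forall a, a = \sum_(C | clique C) k a C *: face C,
      forall C, clique C -> k 0 C = 0,
      forall (x : F) a b C, clique C -> k (x *: a + b) C = x * k a C + k b C &
      forall C D, clique C -> clique D -> k (face C) D = (D == C)%:R].
Proof.
have /choice[k kE] : forall a, exists c : {set Gamma} -> F,
    a = \sum_(C | clique C) c C *: face C.
  move=> a; have [c ->] := face_span_all a; exists c.
  by apply: eq_bigl => C; rewrite andbT.
have kU a c C : a = \sum_(C | clique C) c C *: face C -> clique C ->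
    k a C = c C.
  move=> ac cC; apply/eqP; rewrite -subr_eq0; apply/eqP.
  apply: (u_free (c := fun C => k a C - c C)) => //.
  under eq_bigr => D _ do rewrite scalerBl.
  by rewrite sumrB -kE -ac subrr.
exists k; split=> // [C cC|x a b C cC|C D cC cD].
  by apply: (kU _ (fun=> 0)) => //; rewrite big1 // => D _; rewrite scale0r.
  apply: (kU _ (fun C => x * k a C + k b C)) => //.
  under eq_bigr => D _ do rewrite scalerDl -scalerA.
  by rewrite big_split -scaler_sumr -!kE.
apply: (kU _ (fun D => (D == C)%:R)) => //.
rewrite (bigD1 C) //= eqxx scale1r big1 ?addr0 // => E /andP[_ /negPf->].
by rewrite scale0r.
Qed.

(** If v is not adjacent to r then u_v x u_r = 0 for all x, since u_v can be
moved next to u_r. Conversely, let a u_r lie in (Y), and let C be a clique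
that neither meets Y nor contains a vertex that is not adjacent to r. The
coordinate of a u_r at C and r is, up to sign, that of a at C, because no
other face yields that face when multiplied by u_r. It is zero, as C and r do
not meet Y. *)
Theorem colon_gens Y r : r \notin Y ->
  colon (ideal_gen (gens Y)) (ideal_gen [set u r]%classic) =
  ideal_gen (gens (Y :|: [set v | ~~ adj v r])).
Proof.
move=> rY; set I := ideal_gen (gens Y); set Z := _ :|: _.
have idI : is_ideal I := ideal_gen_ideal _.
have [I0 ID Il Ir] := idI.
apply/seteqP; split=> a; last first.
  apply; first split=> [b _|x y cx cy b Jb|x y cy b Jb|x y cx b Jb].
  - by rewrite mul0r.
  - by rewrite mulrDl; exact: ID _ _ (cx b Jb) (cy b Jb).
  - by rewrite -mulrA; exact: Il _ _ (cy b Jb).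
  - rewrite -mulrA; apply: cx.
    by have [_ _ Jl _] := ideal_gen_ideal [set u r]%classic; apply: Jl.
  (* For v not adjacent to r, the elements b with u v * x * b in (Y) for all x
     form a two-sided ideal, which contains u r. *)
  move=> _ [v + <-] b; rewrite /= !inE => /orP[vY _|vr].
    by apply: (Ir (u v)) => J idJ; apply; exists v.
  move=> /(_ [set b | forall x, I (u v * (x * b))]%classic) H.
  suff /(_ 1) : (forall x, I (u v * (x * b))) by rewrite mul1r.
  apply: H => [|_ -> x /=].
    split=> [x|x y Hx Hy z|x y Hy z|x y Hx z] /=.
    - by rewrite !mulr0.
    - by rewrite !mulrDr; exact: ID _ _ (Hx z) (Hy z).
    - by rewrite (mulrA z); exact: Hy.
    - by rewrite (mulrA z) mulrA; exact: Ir _ _ (Hx z).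
  suff -> : u v * (x * u r) = 0 by [].
  move: x; apply: u_span => [|k x y IHx IHy|w x IHx].
  - by rewrite mul1r u_nonadj.
  - by rewrite mulrDl mulrDr -scalerAl -scalerAr IHx IHy scaler0 addr0.
  - by rewrite -mulrA mulrA u_anti mulNr -mulrA IHx mulr0 oppr0.
move=> /(_ (u r)) aI; have {}aI : I (a * u r).
  by apply: aI => J _; apply; exact: erefl.
have [k [kE k0 kL kF]] := face_coord.
have kYZ C : clique C -> [disjoint C & Z] -> k a C = 0.
  move=> cC dC; have Cr w : w \in C -> adj r w.
    move=> wC; have := disjointFr dC wC.
    by rewrite !inE adj_sym => /norP[_ /negPn].
  have rC : r \notin C by apply: contraFN (adj_irr r) => /Cr.
  have cE : clique (r |: C) by apply: clique_setU1.
  have : k (a * u r) (r |: C) = 0.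
    move: (gens_face_span aI); move: (a * u r).
    apply: face_span_ind => [|x b d IHb IHd|D cD DY]; first exact: k0.
      by rewrite kL // IHb IHd mulr0 addr0.
    rewrite kF //; case: eqP => // DE; case/negP: DY; rewrite -DE.
    apply/pred0P => w; apply/negbTE; rewrite /= !inE.
    apply/andP => -[/orP[/eqP->|wC] wY]; first by rewrite wY in rY.
    by have := disjointFr dC wC; rewrite !inE wY.
  (* Only the face C contributes to this coordinate of a * u r. *)
  have kr D : clique D -> k (face D * u r) (r |: C) =
      if D == C then k (face C * u r) (r |: C) else 0.
    move=> cD; case: eqP => [->//|DC].
    have [n ->] := face_gen r D; rewrite -[_ *: _]addr0 kL // k0 // addr0.
    case: (gen_faceP r cD) => [w _ _|m rD cD' _]; first by rewrite k0 ?mulr0.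
    rewrite -[_ *: _]addr0 kL // k0 // addr0 kF //.
    case: eqP => [E|]; last by rewrite !mulr0.
    by case: DC; rewrite -(setU1K rD) -E setU1K.
  rewrite {1}(kE a) mulr_suml.
  have -> : k (\sum_(D | clique D) k a D *: face D * u r) (r |: C) =
      \sum_(D | clique D) k a D * k (face D * u r) (r |: C).
    elim/big_rec2: _ => [|D x b cD <-]; first exact: k0.
    by rewrite -scalerAl kL.
  rewrite (bigD1 C) //= big1 ?addr0 => [|D /andP[cD DC]]; last first.
    by rewrite kr // (negPf DC) mulr0.
  move/eqP; rewrite mulf_eq0 => /orP[/eqP //|].
  have [n ->] := face_gen r C; rewrite -[_ *: _]addr0 kL // k0 // addr0.
  case: (gen_faceP r cC) => [w wC|m _ _ _]; first by rewrite Cr.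
  rewrite -[_ *: _]addr0 kL // k0 // addr0 kF // eqxx mulr1.
  by rewrite mulf_eq0 !signr_eq0.
have [Z0 ZD _ _] := ideal_gen_ideal (gens Z).
rewrite (kE a); elim/big_ind: _ => // C cC.
have [dC|nC] := boolP [disjoint C & Z]; first by rewrite kYZ // scale0r.
exact: ideal_genZ (ideal_gen_ideal _) (face_ideal nC).
Qed.
End ExteriorFaceRing.

(** * Evaluation of tensors *)

Section TensorAlgebra.
Variables (F : fieldType) (I : finType).
Notation T := (seqalg I F).
Implicit Types (i : I) (f g : seq I -> F) (a b : T) (s : seq I).

Definition supported_below N f := forall s, (N <= size s)%N -> f s = 0.

Definition letter i : T := SeqAlg (bounded_fun1 (fun j => (j == i)%:R)).

(** A tensor is its constant term plus the sum over the letters i of i times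
the tensor of the words that follow i. *)
Lemma tensor_ind (P : T -> Prop) : P 1 ->
  (forall k a b, P a -> P b -> P (k *: a + b)) ->
  (forall i a, P a -> P (letter i * a)) -> forall a, P a.
Proof.
move=> P1 Plin PM a; have P0 : P 0 by rewrite -(subrr 1) addrC -scaleN1r;
  apply: Plin.
case: a => f fP; move/asboolP: (fP) => [N]; elim: N f fP => [|N IHN] f fP fN.
  by rewrite (_ : SeqAlg fP = 0) //; apply: seqalgP => s; apply: fN.
have fiN i : supported_below N (fun s => f (i :: s)) by move=> s Ns; apply: fN.
have bi i : bounded_deg (fun s => f (i :: s)) by apply/asboolP; exists N;
  apply: fiN.
have -> : SeqAlg fP = f [::] *: 1 + \sum_i letter i * SeqAlg (bi i).
  apply: seqalgP => s; rewrite [RHS](_ : _ = f [::] * seq_one F s +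
    \sum_i seq_mul (letter i) (fun s => f (i :: s)) s); last first.
    congr (_ + _); exact: (big_morph (fun b : T => b s)).
  case: s => [|j s]; under eq_bigr => i _ do rewrite seq_mul_fun1.
    by rewrite big1 // addr0 mulr1.
  rewrite mulr0 add0r (bigD1 j) //= eqxx mul1r big1 ?addr0 // => i /negPf ij.
  by rewrite eq_sym ij mul0r.
apply: (Plin) => //; elim/big_ind: _ => // [x y Px Py|i _].
  by rewrite -[x]scale1r; apply: Plin.
by apply: PM; apply: IHN; apply: fiN.
Qed.

Section Evaluation.
Variables (A : algType F) (u : I -> A).

(** The value of the noncommutative polynomial f at u, computed letter by
letter; N bounds the length of the words that are taken into account. *)
Fixpoint eval_upto N f : A :=
  if N is M.+1 then f [::] *: 1 + \sum_i u i * eval_upto M (fun s => f (i :: s))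
  else 0.

Lemma eval_upto_lin N k f g :
  eval_upto N (fun s => k * f s + g s) = k *: eval_upto N f + eval_upto N g.
Proof.
elim: N f g => [|N IHN] f g /=; first by rewrite scaler0 addr0.
rewrite scalerDl scalerDr scalerA addrACA; congr (_ + _).
rewrite scaler_sumr -big_split; apply: eq_bigr => i _ /=.
by rewrite IHN mulrDr scalerAr.
Qed.

Lemma eval_upto0 N : eval_upto N (fun=> 0) = 0.
Proof.
elim: N => //= N ->; rewrite scale0r add0r big1 // => i _.
by rewrite mulr0.
Qed.

Lemma eval_upto_stable N M f : supported_below N f -> (N <= M)%N ->
  eval_upto M f = eval_upto N f.
Proof.
elim: N M f => [|N IHN] M f fN.
  by rewrite (_ : f = fun=> 0) ?eval_upto0 //; apply/funext => s; apply: fN.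
case: M => // M; rewrite ltnS => NM /=; congr (_ + _).
apply: eq_bigr => i _; rewrite (IHN M) // => s Ns.
exact: fN.
Qed.

Lemma eval_uptoM N M f g : supported_below N f -> supported_below M g ->
  eval_upto (N + M) (seq_mul f g) = eval_upto N f * eval_upto M g.
Proof.
move=> + gM; elim: N f => [|N IHN] f fN.
  rewrite mul0r (_ : seq_mul f g = fun=> 0) ?eval_upto0 //.
  by apply/funext => s; apply: big1 => i _; rewrite fN // mul0r.
rewrite addSn /= seq_mul_nil mulrDl -{1}(eval_upto_stable gM (leq_addl N.+1 M)).
rewrite addSn /= -!scalerAl mul1r scalerDr scalerA -addrA; congr (_ + _).
rewrite scaler_sumr mulr_suml -big_split; apply: eq_bigr => i _ /=.
rewrite (_ : (fun s => seq_mul f g (i :: s)) = (fun s =>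
  f [::] * g (i :: s) + seq_mul (fun t => f (i :: t)) g s)); last first.
  by apply/funext => s; rewrite seq_mul_cons.
rewrite eval_upto_lin mulrDr scalerAr IHN; last by move=> s Ns; apply: fN.
by rewrite mulrA.
Qed.

Definition tensor_bound (a : T) : nat :=
  xget 0%N [set N | supported_below N a]%classic.

Lemma tensor_boundP (a : T) : supported_below (tensor_bound a) a.
Proof.
have [N aN] : exists N, supported_below N a.
  by case: a => f fP; apply/asboolP.
by have := @xgetPex _ 0%N [set N | supported_below N a]%classic; apply;
  exists N.
Qed.

Definition eval (a : T) : A := eval_upto (tensor_bound a) a.

Lemma evalE N (a : T) : supported_below N a -> eval a = eval_upto N a.
Proof.
move=> aN; rewrite /eval.
rewrite -(eval_upto_stable (@tensor_boundP a) (leq_maxl _ N)).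
by rewrite (eval_upto_stable aN (leq_maxr _ _)).
Qed.

Lemma supported_belowW N M f : (N <= M)%N ->
  supported_below N f -> supported_below M f.
Proof. by move=> NM fN s Ms; apply: fN; apply: leq_trans Ms. Qed.

Lemma eval_is_linear : linear eval.
Proof.
move=> k a b; pose N := maxn (tensor_bound a) (tensor_bound b).
have aN : supported_below N a.
  exact: supported_belowW (leq_maxl _ _) (@tensor_boundP a).
have bN : supported_below N b.
  exact: supported_belowW (leq_maxr _ _) (@tensor_boundP b).
rewrite (evalE aN) (evalE bN) -eval_upto_lin; apply: evalE => s Ns.
by rewrite -[LHS]/(k * a s + b s) aN // bN // mulr0 addr0.
Qed.

Lemma evalM a b : eval (a * b) = eval a * eval b.
Proof.
rewrite -eval_uptoM; try exact: tensor_boundP.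
apply: evalE => s Ns; apply: big1 => i _.
have [le_i|lt_i] := leqP (tensor_bound a) i.
  rewrite (@tensor_boundP a) ?mul0r // size_takel // -ltnS //.
rewrite (@tensor_boundP b) ?mulr0 // size_drop leq_subRL; last by rewrite -ltnS.
by apply: leq_trans Ns; rewrite leq_add2r ltnW.
Qed.

Lemma eval1 : eval 1 = 1.
Proof.
rewrite (evalE (N := 1)); last by case.
by rewrite /= scale1r big1 ?addr0 // => i _; rewrite mulr0.
Qed.

Lemma eval_letter i : eval (letter i) = u i.
Proof.
rewrite (evalE (N := 2)) /=; last by case=> [|j [|k s]].
have z : \sum_k u k * 0 = 0 by rewrite big1 // => k _; rewrite mulr0.
rewrite scale0r add0r z (bigD1 i) //= big1 => [|j /negPf ji].
  by rewrite eqxx scale1r !addr0 mulr1.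
by rewrite ji scale0r addr0 mulr0.
Qed.

Lemma eval_homog (gr : nat -> set A) :
  is_grading gr -> (forall i, gr 1%N (u i)) ->
  forall n a, homog n a -> gr n (eval a).
Proof.
case=> grS gr1 grM _ _ gru n a; rewrite /eval; move: (tensor_bound a) => N.
case: a => f fP; rewrite /homog /= {fP}; elim: N n f => [|N IHN] n f fn /=.
  by have [] := grS n.
have [gn0 gnlin] := grS n.
case: n fn gn0 gnlin => [|n] fn gn0 gnlin.
  rewrite big1 => [|i _]; first exact: gnlin.
  by rewrite (_ : (fun s => f (i :: s)) = fun=> 0) ?eval_upto0 ?mulr0 //;
    apply/funext => s; apply: fn.
rewrite fn // scale0r add0r; elim/big_ind: _ => // [x y gx gy|i _].
  by rewrite -[x]scale1r; apply: (gnlin).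
by rewrite -add1n; apply: grM => //; apply: IHN => s sn; apply: fn.
Qed.
End Evaluation.

Lemma letter_homog i n a : homog n a -> homog n.+1 (letter i * a).
Proof.
move=> na s ns; rewrite -[LHS]/(seq_mul (letter i) a s) seq_mul_fun1.
by case: s ns => //= j s ns; rewrite na ?mulr0.
Qed.
End TensorAlgebra.

(** * Graded exterior face algebras are strongly Koszul *)

Section StronglyKoszul.
Variables (Gamma : sgraph) (F : fieldType) (A : gralgType F) (u : Gamma -> A).
Hypothesis u_nonadj : forall v w, ~~ adj v w -> u v * u w = 0.
Hypothesis u_anti : forall v w, u v * u w = - (u w * u v).
Hypothesis u_span : forall P : A -> Prop, P 1 ->
  (forall k a b, P a -> P b -> P (k *: a + b)) ->
  (forall v a, P a -> P (u v * a)) -> forall a, P a.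
Hypothesis u_free : forall c : {set Gamma} -> F,
  \sum_(C | clique C) c C *: face u C = 0 -> forall C, clique C -> c C = 0.
Hypothesis u_degree : forall v, grpart A 1 (u v).

Lemma grpart_lin n k a b :
  grpart A n a -> grpart A n b -> grpart A n (k *: a + b).
Proof. by have [/(_ n)[_ H] _ _ _ _] := gralgP A; apply: H. Qed.

Lemma grpart0 n : grpart A n 0.
Proof. by have [/(_ n)[]] := gralgP A. Qed.

Lemma grpart_sum n (J : Type) (r : seq J) (P : pred J) (c : J -> F)
    (a : J -> A) : (forall j, P j -> grpart A n (a j)) ->
  grpart A n (\sum_(j <- r | P j) c j *: a j).
Proof.
move=> na; elim/big_rec: _ => [|j x Pj nx]; first exact: grpart0.
by apply: grpart_lin => //; apply: na.
Qed.

Lemma mono_degree s : grpart A (size s) (mono u s).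
Proof.
have [_ gr1 grM _ _] := gralgP A.
elim: s => [|v s IHs]; first by rewrite /mono big_nil.
by rewrite mono_cons -[size _]add1n; apply: grM.
Qed.

Lemma face_degree (C : {set Gamma}) : grpart A #|C| (face u C).
Proof. by rewrite cardE; apply: mono_degree. Qed.

(** The components of a in the face basis, sorted by degree, are its
components for the grading, which are unique. *)
Lemma face_homogeneous n a : grpart A n a -> exists c : {set Gamma} -> F,
  a = \sum_(C | clique C && (#|C| == n)) c C *: face u C.
Proof.
move=> na; have [c ac] := face_span_all u_nonadj u_anti u_span a.
exists c; pose N := maxn n.+1 #|Gamma|.+1.
(* The component of degree m of the zero element written as the sum of the faces
   of a minus a. *)
pose comp m := 1 *: (if m == n then -1 *: a else 0) +
  \sum_(C | clique C && (#|C| == m)) c C *: face u C.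
have CN (C : {set Gamma}) : (#|C| < N)%N.
  by rewrite leq_max !ltnS max_card orbT.
have nN : (n < N)%N by rewrite leq_max leqnn.
have gr_comp m : grpart A m (comp m).
  apply: grpart_lin; last by apply: grpart_sum => C /andP[_ /eqP <-];
    apply: face_degree.
  case: eqP => [->|_]; last exact: grpart0.
  by rewrite -[_ *: a]addr0; apply: grpart_lin => //; apply: grpart0.
have sum_comp : \sum_(m < N) comp m = 0.
  rewrite big_split /=; under eq_bigr => m _ do rewrite scale1r.
  rewrite -big_mkcond (big_pred1 (Ordinal nN)) => [|m //].
  rewrite (exchange_big_dep (@clique Gamma)) /= => [|m C _ /andP[]//].
  rewrite {1}ac -(eq_bigl _ _ (fun C => andbT (clique C))).
  rewrite scaleN1r -sumrN -big_split big1 //= => C /andP[cC _].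
  rewrite (big_pred1 (Ordinal (CN C))) ?addNr // => m.
  by rewrite cC eq_sym.
have [_ _ _ _ /(_ N comp gr_comp sum_comp n nN)] := gralgP A.
by rewrite /comp eqxx scale1r scaleN1r addrC => /eqP; rewrite subr_eq0 => /eqP.
Qed.

Notation d := #|Gamma|.

Definition base_gen (i : 'I_d) : A := u (enum_val i).

Lemma base_gen_basis : is_basis (grpart A 1) base_gen.
Proof.
split=> [i|a na|c c0 i]; first exact: u_degree.
  have [c ->] := face_homogeneous na.
  elim/big_rec: _ => [|C _ /andP[_ /cards1P[v ->]] [e ->]].
    by exists (fun=> 0); rewrite big1 // => i _; rewrite scale0r.
  exists (fun i => c [set v]%SET * (i == enum_rank v)%:R + e i).
  under [RHS]eq_bigr => i _ do rewrite scalerDl.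
  rewrite big_split face1; congr (_ + _).
  rewrite (bigD1 (enum_rank v)) //= eqxx mulr1 big1 ?addr0 => [|i /negPf ->].
    by rewrite /base_gen enum_rankK.
  by rewrite mulr0 scale0r.
have [k [kE k0 kL kF]] := face_coord u_nonadj u_anti u_span u_free.
have := k0 _ (clique1 (enum_val i)); rewrite -c0.
have -> : k (\sum_i c i *: base_gen i) [set enum_val i]%SET =
    \sum_j c j * (i == j)%:R.
  elim/big_rec2: _ => [|j x b _ <-]; first exact: k0 (clique1 _).
  rewrite kL ?clique1 // /base_gen -face1 kF ?clique1 // (inj_eq set1_inj)
    (inj_eq enum_val_inj) //.
rewrite (bigD1 i) //= eqxx mulr1 big1 ?addr0 // => j /negPf.
by rewrite eq_sym => ->; rewrite mulr0.
Qed.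

Lemma colon_base_gen (k : nat) (idx : 'I_k -> 'I_d) : injective idx ->
  forall r : 'I_k, exists Y : set 'I_d,
  (colon (ideal_gen [set base_gen (idx j) | j in [set j : 'I_k | (j < r)%N]])
        (ideal_gen [set base_gen (idx r)])
  = ideal_gen (base_gen @` Y))%classic.
Proof.
move=> idxI r; pose Y := [set enum_val (idx j) | j : 'I_k & (j < r)%N]%SET.
have rY : enum_val (idx r) \notin Y.
  apply/imsetP => -[j]; rewrite inE => jr /enum_val_inj /idxI rj.
  by rewrite rj ltnn in jr.
pose Z := Y :|: [set v | ~~ adj v (enum_val (idx r))]%SET.
have YE : ([set base_gen (idx j) | j in [set j : 'I_k | (j < r)%N]] =
    gens u Y)%classic.
  apply/seteqP; split=> a /= [].
    move=> j jr <-; exists (enum_val (idx j)) => //.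
    by apply/imsetP; exists j; rewrite ?inE.
  by move=> v /imsetP[j]; rewrite inE => jr -> <-; exists j.
exists [set i | enum_val i \in Z]%classic.
rewrite YE (colon_gens u_nonadj u_anti u_span u_free rY); congr ideal_gen.
apply/seteqP; split=> a /= [v vZ <-].
  by exists (enum_rank v); rewrite /base_gen /= enum_rankK.
by exists (enum_val v).
Qed.

Notation T := (tensor_alg F d).
Notation eval_gen := (@eval F 'I_d A base_gen).

HB.instance Definition _ := GRing.isLinear.Build F T A _ eval_gen
  (eval_is_linear base_gen).

(** These include the anticommutation and vanishing relations of the u v, so
that the quotient is again spanned by its faces. *)
Definition eval_rels : set T := [set a | homog 2 a /\ eval_gen a = 0]%classic.

Lemma eval_rels_subspace : is_subspace eval_rels.
Proof.
split=> [|k a b [a2 a0] [b2 b0]]; first by split; [move=> s _|rewrite linear0].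
split; last by rewrite linearP /= a0 b0 scaler0 addr0.
by move=> s ns; rewrite -[LHS]/(k * a s + b s) a2 // b2 // mulr0 addr0.
Qed.

Lemma eval_rels_homog : (eval_rels `<=` @homog 'I_d F 2)%classic.
Proof. by move=> a []. Qed.

Definition face_rels : quad_rels F d :=
  QuadRels eval_rels_subspace eval_rels_homog.

Notation Q := (quot_alg (quad_ideal face_rels)).
Notation qpi := (quot_pi (quad_ideal face_rels)).

Lemma eval_ideal a : ideal_gen face_rels a -> eval_gen a = 0.
Proof.
move=> /(_ [set a | eval_gen a = 0]%classic); apply; last by move=> b [].
split=> [|x y Hx Hy|x y Hy|x y Hx] /=; first by rewrite linear0.
- by rewrite linearD /= Hx Hy addr0.
- by rewrite [LHS]evalM Hy mulr0.
- by rewrite [LHS]evalM Hx mul0r.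
Qed.

Definition quot_eval (x : Q) : A := eval_gen (repr x).

Lemma quot_evalE a : quot_eval (qpi a) = eval_gen a.
Proof.
apply/eqP; rewrite -subr_eq0 -linearB; apply/eqP/eval_ideal.
exact: (@quot_repr _ _ (quad_ideal face_rels)) a.
Qed.

Lemma quot_eval_is_linear : linear quot_eval.
Proof.
move=> k x y; have [a ->] := quot_piS x; have [b ->] := quot_piS y.
by rewrite -linearP !quot_evalE linearP.
Qed.

Lemma quot_eval_is_monoid : monoid_morphism quot_eval.
Proof.
split=> [|x y]; first by rewrite -[1]/(qpi 1) quot_evalE [LHS]eval1.
have [a ->] := quot_piS x; have [b ->] := quot_piS y.
by rewrite -rmorphM !quot_evalE [LHS]evalM.
Qed.

HB.instance Definition _ := GRing.isLinear.Build F Q A _ quot_eval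
  quot_eval_is_linear.
HB.instance Definition _ := GRing.isMonoidMorphism.Build Q A quot_eval
  quot_eval_is_monoid.

Definition tensor_gen (v : Gamma) : T := letter F (enum_rank v).
Definition quot_gen (v : Gamma) : Q := qpi (tensor_gen v).

Lemma eval_tensor_gen v : eval_gen (tensor_gen v) = u v.
Proof. by rewrite [LHS]eval_letter /base_gen enum_rankK. Qed.

Lemma tensor_mono_homog s : homog (size s) (mono tensor_gen s).
Proof.
elim: s => [|v s IHs]; first by rewrite /mono big_nil => -[].
by rewrite mono_cons; apply: letter_homog.
Qed.

Lemma tensor_gen2_homog v w : homog 2 (tensor_gen v * tensor_gen w).
Proof.
have := @tensor_mono_homog [:: v; w].
by rewrite !mono_cons /mono big_nil mulr1.
Qed.

Lemma eval_tensor_mono s : eval_gen (mono tensor_gen s) = mono u s.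
Proof.
elim: s => [|v s IHs]; first by rewrite /mono !big_nil [LHS]eval1.
by rewrite !mono_cons [LHS]evalM IHs; congr (_ * _); apply: eval_tensor_gen.
Qed.

Lemma qpi_rels a : homog 2 a -> eval_gen a = 0 -> qpi a = 0.
Proof.
move=> a2 a0; rewrite -(linear0 qpi); apply/quot_piP; rewrite subr0.
by move=> J _; apply.
Qed.

Lemma quot_gen_nonadj v w : ~~ adj v w -> quot_gen v * quot_gen w = 0.
Proof.
move=> vw; rewrite -rmorphM; apply: qpi_rels; first exact: tensor_gen2_homog.
by rewrite [LHS]evalM !eval_tensor_gen u_nonadj.
Qed.

Lemma quot_gen_anti v w : quot_gen v * quot_gen w = - (quot_gen w * quot_gen v).
Proof.
apply/eqP; rewrite -addr_eq0 -!rmorphM -rmorphD; apply/eqP; apply: qpi_rels.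
  move=> s ns; rewrite -[LHS]/((tensor_gen v * tensor_gen w) s +
    (tensor_gen w * tensor_gen v) s).
  by rewrite !tensor_gen2_homog // addr0.
by rewrite linearD /= !evalM !eval_tensor_gen u_anti addNr.
Qed.

Lemma quot_gen_span (P : Q -> Prop) : P 1 ->
  (forall k a b, P a -> P b -> P (k *: a + b)) ->
  (forall v a, P a -> P (quot_gen v * a)) -> forall a, P a.
Proof.
move=> P1 Plin PM x; have [a ->] := quot_piS x; move: a.
apply: tensor_ind => [|k a b Pa Pb|i a Pa]; first exact: P1.
  by rewrite linearP; apply: Plin.
by rewrite rmorphM -[i]enum_valK; apply: PM.
Qed.

Lemma quot_eval_face C : quot_eval (face quot_gen C) = face u C.
Proof.
rewrite -[RHS]eval_tensor_mono -quot_evalE; congr quot_eval.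
by rewrite /face /mono rmorph_prod.
Qed.

(** The quotient is spanned by its faces, whose images are independent. *)
Lemma quot_eval_inj : injective quot_eval.
Proof.
suff inj0 x : quot_eval x = 0 -> x = 0 by exact: raddf_inj inj0.
have [c ->] :=
  face_span_all quot_gen_nonadj quot_gen_anti quot_gen_span x.
under eq_bigl => C do rewrite andbT.
rewrite linear_sum /=.
under eq_bigr => C _ do rewrite linearZ /= quot_eval_face.
by move=> /u_free c0; rewrite big1 // => C /c0 ->; rewrite scale0r.
Qed.

Lemma eval_homog_surj n a : grpart A n a ->
  exists2 b, homog n b & eval_gen b = a.
Proof.
move=> /face_homogeneous[c ->].
elim/big_rec: _ => [|C _ /andP[_ /eqP Cn] [b nb <-]].
  by exists 0; [move=> s _|rewrite linear0].
exists (c C *: mono tensor_gen (enum C) + b).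
  move=> s ns; rewrite -[LHS]/(c C * mono tensor_gen (enum C) s + b s).
  by rewrite nb // tensor_mono_homog ?mulr0 ?addr0 // -cardE Cn.
by rewrite linearP /= eval_tensor_mono.
Qed.

Lemma quot_eval_surj a : exists x, quot_eval x = a.
Proof.
have [_ _ _ /(_ a)[N [c [cn ->]]] _] := gralgP A.
elim/big_rec: _ => [|n _ _ [y <-]]; first by exists 0; rewrite linear0.
have [b _ <-] := eval_homog_surj (cn n); exists (qpi b + y).
by rewrite linearD -quot_evalE.
Qed.

Lemma exterior_quadratic : quadratic A.
Proof.
exists d, face_rels, (quot_eval : {lrmorphism Q -> A}); split.
  have /choice[g gK] := quot_eval_surj.
  by exists g => [x|a]; [apply: quot_eval_inj; rewrite gK|exact: gK].
move=> n; apply/seteqP; split=> a.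
  move=> [_ [b nb <-] <-].
  rewrite /= quot_evalE; apply: (eval_homog (gralgP A)) nb => i.
  exact: u_degree.
move=> /eval_homog_surj[b nb <-].
by exists (qpi b); [exists b|rewrite /= quot_evalE].
Qed.

Theorem exterior_strongly_koszul : strongly_koszul A.
Proof.
split; first exact: exterior_quadratic.
exists d, base_gen; split=> [|k idx idxI r _]; first exact: base_gen_basis.
exact: colon_base_gen.
Qed.
End StronglyKoszul.

Theorem theorem1p1 (Gamma : sgraph) (F : finFieldType) :
  strongly_koszul (cohomology (raag Gamma) F).
Proof.
apply: (@exterior_strongly_koszul Gamma F _ (@chi_class Gamma F)).
- exact: chi_class_nonadj.
- exact: chi_class_anticomm.
- exact: chi_class_span.
- exact: chi_class_clique_free.
- exact: chi_class_degree.
Qed.
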